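(* Let $\rho$ be an invariant Vishik-Fursikov measure on $\mathcal{C}_{\mathrm{w}}=\mathcal{C}_{\mathrm{loc}}([0,\infty),H_{\mathrm{w}})$ for the three-dimensional incompressible Navier-Stokes equations, and let $\operatorname{Lim}_{T\to\infty}$ and $\operatorname{Lim}'_{T\to\infty}$ be two generalized limits. Then, for $\rho$-almost every Leray-Hopf weak solution $\mathbf{u}$ on $[0,\infty)$, the time-average stationary statistical solutions $\mu_{\mathbf{u}}$ and $\mu_{\mathbf{u}}'$ associated with $\mathbf{u}$ and with $\operatorname{Lim}_{T\to\infty}$ and $\operatorname{Lim}'_{T\to\infty}$, respectively, that is, satisfying $$\operatorname{Lim}_{T\to\infty}\frac1T\int_0^T\Phi(\mathbf{u}(t))\,\mathrm{d}t=\int_H\Phi(\mathbf{v})\,\mathrm{d}\mu_{\mathbf{u}}(\mathbf{v}),\qquad \operatorname{Lim}'_{T\to\infty}\frac1T\int_0^T\Phi(\mathbf{u}(t))\,\mathrm{d}t=\int_H\Phi(\mathbf{v})\,\mathrm{d}\mu'_{\mathbf{u}}(\mathbf{v})$$ for every bounded Borel-measurable function $\Phi:H\to\mathbb{R}$, are identical, i.e. $\mu_{\mathbf{u}}=\mu_{\mathbf{u}}'$ as measures on $H$.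
   Context: Setting. Let $\Omega\subset\mathbb{R}^3$ be a bounded domain with smooth boundary $\partial\Omega$, let $\nu>0$, and let $\mathbf{f}\in H$ be time-independent, with $H$ defined below. The incompressible Navier-Stokes equations for the velocity $\mathbf{u}=\mathbf{u}(t,\mathbf{x})$ and pressure $p=p(t,\mathbf{x})$ are $$\frac{\partial\mathbf{u}}{\partial t}-\nu\Delta\mathbf{u}+(\mathbf{u}\cdot\nabla)\mathbf{u}+\nabla p=\mathbf{f},\qquad \nabla\cdot\mathbf{u}=0\quad\text{on }(0,\infty)\times\Omega,\qquad \mathbf{u}=0\quad\text{on }(0,\infty)\times\partial\Omega.$$ Spaces. $H$ (resp. $V$) is the closure in $L^2(\Omega)^3$ (resp. in $H_0^1(\Omega)^3$) of the space of infinitely differentiable divergence-free vector fields with compact support in $\Omega$, with the inherited inner product. $H_{\mathrm{w}}$ is $H$ endowed with its weak topology; the Borel $\sigma$-algebras of $H$ and $H_{\mathrm{w}}$ coincide. $\mathcal{C}_{\mathrm{w}}=\mathcal{C}_{\mathrm{loc}}([0,\infty),H_{\mathrm{w}})$ is the space of continuous functions from $[0,\infty)$ into $H_{\mathrm{w}}$, endowed with the topology of uniform convergence on compact subintervals of $[0,\infty)$ with values in $H_{\mathrm{w}}$. Leray-Hopf weak solutions. A Leray-Hopf weak solution on $[0,\infty)$ is a function $\mathbf{u}\in L^\infty_{\mathrm{loc}}(0,\infty;H)\cap L^2_{\mathrm{loc}}(0,\infty;V)$ that satisfies the equations in the weak sense, i.e. for every $\mathbf{v}\in V$, $$\frac{\mathrm{d}}{\mathrm{d}t}(\mathbf{u},\mathbf{v})_{L^2}+\nu(\nabla\mathbf{u},\nabla\mathbf{v})_{L^2}+((\mathbf{u}\cdot\nabla)\mathbf{u},\mathbf{v})_{L^2}=(\mathbf{f},\mathbf{v})_{L^2}$$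 in the sense of distributions in time; is strongly continuous in $H$ from the right at $t=0$; and satisfies the energy inequality $$\frac12\frac{\mathrm{d}}{\mathrm{d}t}\|\mathbf{u}\|_{L^2}^2+\nu\|\nabla\mathbf{u}\|_{L^2}^2\le(\mathbf{f},\mathbf{u})_{L^2}$$ in the distribution sense on $[0,\infty)$. Such a solution belongs to $\mathcal{C}_{\mathrm{w}}$. Let $\mathcal{U}\subset\mathcal{C}_{\mathrm{w}}$ be the set of Leray-Hopf weak solutions on $[0,\infty)$; it is a Borel subset of $\mathcal{C}_{\mathrm{w}}$. Operators. $\Pi_0:\mathcal{C}_{\mathrm{w}}\to H_{\mathrm{w}}$, $\Pi_0\mathbf{u}=\mathbf{u}(0)$. For $\tau\ge0$, $\sigma_\tau:\mathcal{C}_{\mathrm{w}}\to\mathcal{C}_{\mathrm{w}}$, $(\sigma_\tau\mathbf{u})(t)=\mathbf{u}(t+\tau)$ for all $t\ge0$. Measures. An invariant (space-time) Vishik-Fursikov measure is a Borel probability measure $\rho$ on $\mathcal{C}_{\mathrm{w}}$ such that $\rho(\mathcal{U})=1$ and $\rho(\sigma_\tau^{-1}\mathcal{E})=\rho(\mathcal{E})$ for every $\tau\ge0$ and every Borel set $\mathcal{E}\subset\mathcal{C}_{\mathrm{w}}$. A Vishik-Fursikov stationary statistical solution is a Borel probability measure on $H$ of the form $\Pi_0\rho$ (push-forward under $\Pi_0$), where $\rho$ is an invariant Vishik-Fursikov measure. Generalized limits. A generalized limit is a positive bounded real-valued linear functional on $L^\infty(0,\infty)$ (functions of $T\in(0,\infty)$)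 which extends the classical limit as $T\to\infty$; it is denoted $\operatorname{Lim}_{T\to\infty}$. Time-average stationary statistical solutions. For a Leray-Hopf weak solution $\mathbf{u}$ and a generalized limit $\operatorname{Lim}_{T\to\infty}$, a time-average stationary statistical solution associated with them is a Vishik-Fursikov stationary statistical solution $\mu_{\mathbf{u}}$ on $H$ such that $\operatorname{Lim}_{T\to\infty}\frac1T\int_0^T\Phi(\mathbf{u}(t))\,\mathrm{d}t=\int_H\Phi\,\mathrm{d}\mu_{\mathbf{u}}$ for every bounded Borel-measurable $\Phi:H\to\mathbb{R}$. *)

(* Defs.v *)
From HB Require Import structures.
From mathcomp Require Import all_boot all_order all_algebra.
From mathcomp Require Import all_classical all_reals all_analysis.
From mathcomp Require Import measurable_realfun.

Set Implicit Arguments.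
Unset Strict Implicit.
Unset Printing Implicit Defensive.

Import Order.TTheory GRing.Theory Num.Theory numFieldNormedType.Exports.

Local Open Scope classical_set_scope.
Local Open Scope ring_scope.

(* The points of R^3 are triples.  [R3m] is the same carrier as [R3]; it pins
   the measurable structure that [lebesgue_measure] is stated for, whereas [R3]
   carries the norm. *)
Notation R3 R := (R * R * R)%type.
Notation R3m R := (measurableTypeR R * measurableTypeR R * measurableTypeR R)%type.

Notation nneg R := (set_type `[(0 : R), +oo[%classic).

Section differential_calculus.
Variable R : realType.

Definition basis3 (i : 'I_3) : R3 R :=
  ((i == 0%N :> nat)%:R, (i == 1%N :> nat)%:R, (i == 2%N :> nat)%:R).

Definition partial (i : 'I_3) (g : R3 R -> R) : R3 R -> R :=
  fun x => 'D_(basis3 i) g x.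

Definition smooth (g : R3 R -> R) : Prop :=
  forall s : seq 'I_3, let h := foldr partial g s in
    continuous h /\ forall i x, derivable h x (basis3 i).

Definition volume : {measure set (R3m R) -> \bar R} :=
  ((@lebesgue_measure R \x @lebesgue_measure R) \x @lebesgue_measure R)%E.

Lemma open_measurable3 (A : set (R3 R)) :
  open A -> measurable (A : set (R3m R)).
Proof.
move=> oA.
pose box (q : rat * rat * rat) (n : nat) : set (R3 R) :=
  ball ((ratr q.1.1, ratr q.1.2, ratr q.2) : R3 R) (n.+1%:R^-1).
suff -> : A = \bigcup_(k in [set k : (rat * rat * rat) * nat |
    box k.1 k.2 `<=` A]) box k.1 k.2.
  rewrite bigcup_mkcond; apply: countable_bigcupT_measurable => [|k].
    exact: countableP.
  case: ifPn => // _; case: k => -[[q1 q2] q3] n.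
  rewrite (_ : box _ _ = (ball (ratr q1 : R) n.+1%:R^-1
     `*` ball (ratr q2 : R) n.+1%:R^-1) `*` ball (ratr q3 : R) n.+1%:R^-1);
    last first.
    by apply/seteqP; split=> -[[x y] z] /=.
  by apply: measurableX; [apply: measurableX|]; apply: open_measurable;
    apply: ball_open; rewrite invr_gt0.
apply/seteqP; split=> [x Ax|x [k kA]]; last exact: kA.
have [e e0 xeA] : exists2 e : R, 0 < e & ball x e `<=` A.
  by move: (open_nbhs_nbhs (conj oA Ax)) => /nbhs_ballP[e /= e0 ?]; exists e.
have [n ne] : exists n : nat, n.+1%:R^-1 < e / 2.
  have e20 : 0 < e / 2 by rewrite divr_gt0.
  have [n _ n0] := near_infty_natSinv_lt (PosNum e20).
  by exists n; apply: (n0 n) => /=.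
have q_ (y : R) : exists q : rat, ball (ratr q : R) n.+1%:R^-1 y.
  have [|q] := @rat_in_itvoo R (y - n.+1%:R^-1) (y + n.+1%:R^-1).
    by rewrite ltrBlDr -addrA ltrDl addr_gt0 ?invr_gt0.
  by rewrite in_itv/= => q12; exists q; rewrite /ball/= ltr_distl.
case: x Ax xeA => -[x1 x2] x3 Ax xeA.
have [[a Ha] [b Hb]] := (q_ x1, q_ x2); have [c Hc] := q_ x3.
have bx : box (a, b, c) n (x1, x2, x3) by [].
exists ((a, b, c), n); last exact: bx.
move=> y yb; apply: xeA.
rewrite (splitr e); apply: (@ball_triangle _ _ ((ratr a, ratr b, ratr c) : R3 R)).
  by apply: ball_sym; apply: le_ball bx; exact: ltW.
by apply: le_ball yb; exact: ltW.
Qed.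

End differential_calculus.

(* A local defining function makes the boundary a smooth surface with [A] on
   one side of it. *)
Definition smooth_boundary (R : realType) (A : set (R3 R)) : Prop :=
  forall x, (closure A `\` A^°) x ->
  exists (U : set (R3 R)) (g : R3 R -> R),
    [/\ open_nbhs x U, smooth g, exists i, partial i g x != 0 &
        forall y, U y -> (A y <-> g y < 0)].

Record smooth_domain (R : realType) := SmoothDomain {
  domain_set :> set (R3 R) ;
  domain_open : open domain_set ;
  domain_nonempty : domain_set !=set0 ;
  domain_connected : connected domain_set ;
  domain_bounded : bounded_set domain_set ;
  domain_boundary : smooth_boundary domain_set }.

Arguments domain_open {R} s.

Section zero_class.
Context d (T : measurableType d) (R : realType).
Variable mu : {measure set T -> \bar R}.

Definition L2_zero_class : {mfun_ mu, T >-> measurableTypeR R} :=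
  (\pi_({mfun_ mu, T >-> measurableTypeR R}) (cst 0))%qT.

Lemma L2_zero_classE : {ae mu, forall x, L2_zero_class x = 0}.
Proof.
have : (repr L2_zero_class == cst 0
    %[mod {mfun_ mu, T >-> measurableTypeR R}])%qT by rewrite reprK.
by rewrite eqmodE => /asboolP; apply: filterS => x /(_ I).
Qed.

Lemma L2_zero_class_finite : finite_norm mu 2%:E L2_zero_class.
Proof.
rewrite /finite_norm.
suff -> : ('N[mu]_2%:E[EFin \o L2_zero_class] = 'N[mu]_2%:E[cst 0])%E.
  by rewrite Lnorm0// ltry.
rewrite unlock /Lnorm; congr (_ `^ _)%E.
apply: ae_eq_integral => //.
- have mf : measurable_fun setT (L2_zero_class : T -> R).
    exact: (measurable_funPT (repr L2_zero_class)).
  have mf1 : measurable_fun setT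
      ((fun x => `|(L2_zero_class x)%:E|%E) : T -> \bar R).
    by apply: measurableT_comp => //; exact/measurable_EFinP.
  exact: (measurableT_comp (measurable_poweR 2) mf1).
- by apply: filterS L2_zero_classE => x /= -> _.
Qed.

HB.instance Definition _ :=
  isFinLebesgue.Build _ _ _ mu 2%:E (lee1n 2) L2_zero_class L2_zero_class_finite.

Definition L2_zero : LspaceType2 mu := L2_zero_class.

End zero_class.

Section function_spaces.
Variables (R : realType) (Omega : smooth_domain R).

(* Lebesgue measure on [Omega], as a measure on R^3 that ignores the complement
   of [Omega]; functions on [Omega] are thus total functions on R^3 taken up to
   equality almost everywhere in [Omega]. *)
Definition dx : {measure set (R3m R) -> \bar R} :=
  mrestr (@volume R) (open_measurable3 (domain_open Omega)).

Definition L2 : Type := LspaceType2 dx.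
HB.instance Definition _ := gen_eqMixin L2.
HB.instance Definition _ := gen_choiceMixin L2.

Definition L2rep (u : L2) : R3 R -> R := (u : LspaceType2 dx).

Definition field : Type := 'I_3 -> R3 R -> R.
Definition L2field : Type := 'I_3 -> L2.
HB.instance Definition _ := Choice.on L2field.

Definition rep (u : L2field) : field := fun i => L2rep (u i).

Definition inner (F G : field) : R :=
  \sum_(i < 3) \int[dx]_x (F i x * G i x).
(* [norm2], [norm2_grad], [norm2_V] and [dist2_V] are squared norms. *)
Definition norm2 (F : field) : R := inner F F.

Definition gradient : Type := 'I_3 -> 'I_3 -> R3 R -> R.
Definition inner_grad (F G : gradient) : R :=
  \sum_(i < 3) \sum_(j < 3) \int[dx]_x (F i j x * G i j x).
Definition norm2_grad (F : gradient) : R := inner_grad F F.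

Definition test_function (g : R3 R -> R) : Prop :=
  smooth g /\
  exists K : set (R3 R), [/\ compact K, K `<=` Omega & forall x, ~ K x -> g x = 0].

Definition test_field : set field := [set phi | forall i, test_function (phi i)].
Definition div_free : set field :=
  [set phi | forall x, \sum_(i < 3) partial i (phi i) x = 0].

Definition Hset : set L2field :=
  [set u | forall e : R, 0 < e ->
    exists2 phi, (test_field `&` div_free) phi &
      norm2 (fun i x => rep u i x - phi i x) < e].

Definition H : Type := set_type Hset.
HB.instance Definition _ := Choice.on H.

Definition Hfield (u : H) : L2field := set_val u.
Definition Hrep (u : H) : field := rep (Hfield u).

(* [G i j] is the weak derivative of the i-th component in direction j. *)
Definition weak_gradient (u : L2field) (G : 'I_3 -> 'I_3 -> L2) : Prop :=
  forall i j g, test_function g ->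
    \int[dx]_x (rep u i x * partial j g x) = - \int[dx]_x (L2rep (G i j) x * g x).

Definition H1set : set L2field := [set u | exists G, weak_gradient u G].

(* Meaningful on [H1set], where the weak gradient exists and is unique. *)
Definition grad (u : L2field) : gradient :=
  fun i j => L2rep (xget (fun k _ => u k) [set G | weak_gradient u G] i j).

Definition closure_H1 (S : set field) : set L2field :=
  [set u | H1set u /\ forall e : R, 0 < e ->
    exists2 phi, S phi &
      norm2 (fun i x => rep u i x - phi i x) +
      norm2_grad (fun i j x => grad u i j x - partial j (phi i) x) < e].

Definition H10set : set L2field := closure_H1 test_field.

Definition Vset : set L2field :=
  H10set `&` closure_H1 (test_field `&` div_free).

Definition norm2_V (u : L2field) : R := norm2 (rep u) + norm2_grad (grad u).
Definition dist2_V (u v : L2field) : R :=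
  norm2 (fun i x => rep u i x - rep v i x) +
  norm2_grad (fun i j x => grad u i j x - grad v i j x).

(* ((u . grad) w, v)_{L^2} = sum_{i,j} int u_j (d_j w_i) v_i *)
Definition convection (u w v : L2field) : R :=
  \sum_(i < 3) \sum_(j < 3)
    \int[dx]_x (rep u j x * grad w i j x * rep v i x).

Lemma Hset0 : Hset (fun=> L2_zero dx).
Proof.
move=> e e0; exists (fun _ _ => 0).
  have s0 s : foldr (@partial R) (fun=> 0) s = (fun=> 0 : R).
    elim: s => [//|i s /= ->]; apply/funext => x.
    by rewrite /partial derive_val.
  split=> [i|x]; last by rewrite big1// => i _; exact: derive_val.
  split; last by exists set0; split => //; exact: compact0.
  move=> s /=; rewrite s0; split; first exact: cst_continuous.
  by move=> j x; exact: derivable_cst.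
rewrite /norm2 /inner big1// => i _.
have mf : measurable_fun setT (L2rep (L2_zero dx) : R3m R -> R).
  exact: (measurable_funPT (repr (L2_zero_class dx))).
rewrite /Rintegral (ae_eq_integral (cst 0%E)) ?integral0//=.
  apply/measurable_EFinP; apply: measurable_funM; exact: measurable_funB.
apply: filterS (L2_zero_classE dx) => x /= x0 _.
by rewrite /rep /L2rep x0 subrr mulr0.
Qed.

HB.instance Definition _ := isPointed.Build H (SigSub (mem_set Hset0)).

Definition open_H : set (set H) :=
  [set A | forall u, A u -> exists2 e : R, 0 < e &
    forall v, norm2 (fun i x => Hrep u i x - Hrep v i x) < e ^+ 2 -> A v].

Definition borel_H := g_sigma_algebraType open_H.

Definition linear_H (l : H -> R) : Prop :=
  forall (a : R) (u v w : H),
    (forall i, {ae dx, forall x, Hrep w i x = a * Hrep u i x + Hrep v i x}) ->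
    l w = a * l u + l v.

Definition bounded_H (l : H -> R) : Prop :=
  exists C : R, forall u, `|l u| <= C * Num.sqrt (norm2 (Hrep u)).

Definition dual_H : Type := set_type [set l : H -> R | linear_H l /\ bounded_H l].

Definition pairing (u : H) : {ptws dual_H -> R} := fun l => set_val l u.

Definition Hw := initial_topology pairing.
HB.instance Definition _ := Uniform.on Hw.
HB.instance Definition _ := Pointed.on Hw.


Fact max0_nneg (t : R) : Num.max 0 t \in `[(0 : R), +oo[%classic.
Proof. by rewrite mem_setE in_itv/= andbT le_max lexx. Qed.

Definition to_nneg (t : R) : nneg R := SigSub (max0_nneg t).

Definition shift (tau t : nneg R) : nneg R := to_nneg (set_val t + set_val tau).

Lemma shift_continuous (tau : nneg R) : continuous (shift tau).
Proof.
have valc : continuous (set_val : nneg R -> R) by exact: initial_continuous.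
have addc : continuous (fun s : nneg R => set_val s + set_val tau : R).
  by move=> s; exact: (cvgD (valc s) (cvg_cst _)).
apply: continuous_comp_initial => t.
by apply: (@continuous_max _ (nneg R) (cst 0)); [exact: cst_continuous|exact: addc].
Qed.

Definition Cw : Type := continuousType (nneg R) Hw.
HB.instance Definition _ := Choice.on Cw.
HB.instance Definition _ := isPointed.Build Cw (cst point : continuousType (nneg R) Hw).

Definition compact_subinterval (K : set (nneg R)) : Prop :=
  exists a b : R, K = [set t | a <= set_val t <= b].

Definition Cw_to_family (u : Cw) : {family compact_subinterval, nneg R -> Hw} :=
  (u : continuousType (nneg R) Hw).

Definition Cw_top := initial_topology Cw_to_family.

Definition borel_Cw := g_sigma_algebraType (@open Cw_top).

Definition Pi0 (u : Cw) : H := (u : continuousType (nneg R) Hw) (to_nneg 0).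

Definition sigma (tau : nneg R) (u : Cw) : Cw :=
  ((u : continuousType (nneg R) Hw) \o mkcts (@shift_continuous tau)
     : continuousType (nneg R) Hw).

Definition at_time (u : Cw) (t : R) : H := (u : continuousType (nneg R) Hw) (to_nneg t).

End function_spaces.

Section navier_stokes.
Variables (R : realType) (Omega : smooth_domain R) (nu : R) (f : H Omega).

Local Notation leb := (@lebesgue_measure R).

Definition test_time (psi : R -> R) : Prop :=
  (forall n t, derivable (derive1n n psi) t 1) /\
  exists a b : R, 0 < a /\ forall t, t < a \/ b < t -> psi t = 0.

Definition Linfty_loc_H (u : R -> H Omega) : Prop :=
  forall a b : R, 0 < a -> exists M : R,
    {ae leb, forall t, a <= t <= b -> Num.sqrt (norm2 Omega (Hrep (u t))) <= M}.

Definition simple_V (s : R -> L2field Omega) : Prop :=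
  [/\ finite_set (range s), forall w, measurable (s @^-1` [set w]) &
      forall t, Vset (s t)].

(* Bochner measurability on (0, +oo), and square integrability of the V-norm on
   compact subintervals. *)
Definition L2_loc_V (u : R -> H Omega) : Prop :=
  [/\ {ae leb, forall t, 0 < t -> Vset (Hfield (u t))},
      exists s : nat -> R -> L2field Omega, (forall n, simple_V (s n)) /\
        {ae leb, forall t, 0 < t ->
          dist2_V (s n t) (Hfield (u t)) @[n --> \oo] --> 0} &
      forall a b : R, 0 < a ->
        (\int[leb]_(t in `[a, b]) (norm2_V (Hfield (u t)))%:E < +oo)%E].

Definition weak_equation (u : R -> H Omega) : Prop :=
  forall v, Vset v -> forall psi, test_time psi ->
    \int[leb]_(t in `]0, +oo[)
      (- inner Omega (Hrep (u t)) (rep v) * derive1 psi t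
       + (nu * inner_grad Omega (grad (Hfield (u t))) (grad v)
          + convection (Hfield (u t)) (Hfield (u t)) v) * psi t)
    = \int[leb]_(t in `]0, +oo[) (inner Omega (Hrep f) (rep v) * psi t).

Definition right_continuous_at0 (u : R -> H Omega) : Prop :=
  norm2 Omega (fun i x => Hrep (u t) i x - Hrep (u 0) i x) @[t --> 0^'+] --> 0.

(* Test functions vanish near t = 0: an inequality between distributions on the
   open half-line, the initial time being reached by [right_continuous_at0]. *)
Definition energy_inequality (u : R -> H Omega) : Prop :=
  forall psi, test_time psi -> (forall t, 0 <= psi t) ->
    \int[leb]_(t in `]0, +oo[)
      (- (norm2 Omega (Hrep (u t)) / 2) * derive1 psi t
       + nu * norm2_grad Omega (grad (Hfield (u t))) * psi t)
    <= \int[leb]_(t in `]0, +oo[) (inner Omega (Hrep f) (Hrep (u t)) * psi t).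

(* Weak continuity into H, which the trajectories in [Cw] satisfy by
   construction, gives the Bochner measurability of [u] as an H-valued map. *)
Definition leray_hopf : set (Cw Omega) :=
  [set u | [/\ Linfty_loc_H (at_time u), L2_loc_V (at_time u),
    weak_equation (at_time u), right_continuous_at0 (at_time u) &
    energy_inequality (at_time u)]].

Definition invariant_VF (rho : probability (borel_Cw Omega) R) : Prop :=
  rho leray_hopf = 1%E /\
  forall (tau : nneg R) (E : set (borel_Cw Omega)), measurable E ->
    rho (sigma tau @^-1` E) = rho E.

Definition VF_stationary (mu : probability (borel_H Omega) R) : Prop :=
  exists2 rho : probability (borel_Cw Omega) R, invariant_VF rho &
    forall A : set (borel_H Omega), measurable A ->
      mu A = pushforward rho (@Pi0 R Omega : borel_Cw Omega -> borel_H Omega) A.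

Definition time_average (u : Cw Omega) (Phi : borel_H Omega -> R) (T : R) : R :=
  T^-1 * \int[leb]_(t in `[0, T]) Phi (at_time u t).

(* A functional on L^oo(0, +oo), given on representatives: its values outside
   [Linfty] are irrelevant. *)
Definition Linfty : {pred R -> R} :=
  Lfun (mrestr leb (measurable_itv `]0, +oo[)) +oo%E.

Record generalized_limit (L : (R -> R) -> R) : Prop := GeneralizedLimit {
  gl_class : forall g h, g \in Linfty -> h \in Linfty ->
    {ae leb, forall t, 0 < t -> g t = h t} -> L g = L h ;
  gl_linear : forall (a : R) g h, g \in Linfty -> h \in Linfty ->
    L (fun t => a * g t + h t) = a * L g + L h ;
  gl_positive : forall g, g \in Linfty ->
    {ae leb, forall t, 0 < t -> 0 <= g t} -> 0 <= L g ;
  gl_bounded : exists C : R, forall g, g \in Linfty ->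
    `|L g| <= C * fine ('N[mrestr leb (measurable_itv `]0, +oo[)]_+oo[EFin \o g]) ;
  gl_extends : forall g (l : R), g \in Linfty ->
    g t @[t --> +oo] --> l -> L g = l }.

Definition time_average_stationary (L : (R -> R) -> R) (u : Cw Omega)
    (mu : probability (borel_H Omega) R) : Prop :=
  VF_stationary mu /\
  forall Phi : borel_H Omega -> R, measurable_fun setT Phi ->
    (exists M : R, forall v, `|Phi v| <= M) ->
    L (time_average u Phi) = \int[mu]_v Phi v.

End navier_stokes.

(* Main.v *)
Require Import Defs.
From HB Require Import structures.
From mathcomp Require Import all_boot all_order all_algebra.
From mathcomp Require Import all_classical all_reals all_analysis.
From mathcomp Require Import measurable_realfun ess_sup_inf.
From mathcomp Require Import ring lra.

(** Two generalized limits agree on every function of T that converges at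
    infinity.  Both measures are therefore determined on a Borel set A of H as
    soon as the fraction of [0, T] that u spends in A converges, and by the
    pointwise ergodic theorem it does for almost every u, rho being invariant
    under time translations.  The exceptional null set depends on A; the point
    is to need only countably many sets A.

    H is separable: the step fields with rational values on a finite grid form
    a countable family approximating every element of H in L^2
    ([step_field_near]).  Finite intersections of the open half-spaces that
    these fields and rational levels define are a countable pi-system, and this
    pi-system generates the Borel sets of H: expanding the square of v - d shows
    that the squared norm of v is the supremum over the step fields d of
    2 (v, d) - (d, d), so balls around step fields are measurable with respect
    to half-spaces, and every open set is a countable union of such balls
    ([open_H_halfspaces]).  Two probability measures that agree on the pi-system
    coincide ([borel_H_measure_unique]).

    The half-spaces are also weakly open, which gives the measurability that the
    ergodic theorem asks for: the coordinate (u(t), d) is continuous in t and,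
    for each t, measurable in u, hence jointly measurable
    ([measurable_fun_caratheodory]).

    The ergodic theorem itself is proved for bounded functions.  In discrete
    time ([birkhoff_ergodic]) Garsia's maximal inequality [maximal_ergodic] is
    applied to the set where the Birkhoff sums S_n satisfy both
    sup (S_n - b n) = +oo and inf (S_n - a n) = -oo for some a < b.  This set is
    exactly invariant, and the integral over it of the summed function would be
    at least b and at most a times its measure, so it is null; off these sets the
    averages converge.  Applying the discrete theorem to the unit-time integral
    of the observable gives the continuous statement
    ([birkhoff_ergodic_continuous]). *)

Set Implicit Arguments.
Unset Strict Implicit.
Unset Printing Implicit Defensive.

Import Order.TTheory GRing.Theory Num.Theory numFieldNormedType.Exports.

Local Open Scope classical_set_scope.
Local Open Scope ring_scope.

(** * The pointwise ergodic theorem in discrete time *)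

Section birkhoff.
Context d (X : measurableType d) (R : realType) (P : probability X R).
Variable T : X -> X.
Hypothesis mT : measurable_fun setT T.
Hypothesis PT : forall E, measurable E -> P (T @^-1` E) = P E.

Definition birkhoff_sum (g : X -> R) n (x : X) : R :=
  \sum_(k < n) g (iter k T x).

Lemma birkhoff_sumS g n x :
  birkhoff_sum g n.+1 x = g x + birkhoff_sum g n (T x).
Proof.
rewrite /birkhoff_sum big_ord_recl; congr (_ + _).
by apply: eq_bigr => k _; rewrite -iterSr.
Qed.

Lemma measurable_birkhoff_sum g n : measurable_fun setT g ->
  measurable_fun setT (birkhoff_sum g n).
Proof.
move=> mg; elim: n => [|n IH].
  have -> : birkhoff_sum g 0 = cst 0; last by [].
  by apply/funext => x; rewrite /birkhoff_sum big_ord0.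
have -> : birkhoff_sum g n.+1 = (fun x => g x + birkhoff_sum g n (T x)).
  by apply/funext => x; rewrite birkhoff_sumS.
by apply: measurable_funD => //; exact: measurableT_comp.
Qed.

(** This is the maximum of the Birkhoff sums of length at most n, the empty sum
    included.  The recursion relates the maximum at x to the one at T x, which is
    what the maximal inequality compares. *)
Fixpoint birkhoff_max (g : X -> R) n (x : X) : R :=
  if n is m.+1 then Num.max 0 (g x + birkhoff_max g m (T x)) else 0.

Lemma birkhoff_max_ge0 g n x : 0 <= birkhoff_max g n x.
Proof. by case: n => //= n; rewrite le_max lexx. Qed.

Lemma birkhoff_max_homo g n x : birkhoff_max g n x <= birkhoff_max g n.+1 x.
Proof.
elim: n x => [x|n IH x]; first exact: birkhoff_max_ge0.
rewrite [leRHS]/= [leLHS]/=.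
have := IH (T x); set a := birkhoff_max g n (T x).
set b := birkhoff_max g n.+1 (T x) => ab.
by rewrite ge_max !le_max lexx/= lerD2l ab orbT.
Qed.

Lemma birkhoff_sum_le_max g n x : birkhoff_sum g n x <= birkhoff_max g n x.
Proof.
elim: n x => [x|n IH x]; first by rewrite /birkhoff_sum big_ord0.
by rewrite birkhoff_sumS/= le_max lerD2l IH orbT.
Qed.

Lemma measurable_birkhoff_max g n : measurable_fun setT g ->
  measurable_fun setT (birkhoff_max g n).
Proof.
move=> mg; elim: n => [|n IH] //=.
apply: measurable_maxr => //; apply: measurable_funD => //.
exact: measurableT_comp.
Qed.

Lemma birkhoff_max_bounded (g : X -> R) (B : R) n x :
  (forall x, `|g x| <= B) -> birkhoff_max g n x <= n%:R * B.
Proof.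
move=> gB; have B0 : 0 <= B by exact: le_trans (gB x).
elim: n x => [x|n IH x] /=; first by rewrite mul0r.
rewrite ge_max mulr_ge0//= -natr1 mulrDl mul1r addrC lerD//.
exact: le_trans (ler_norm _) (gB x).
Qed.

Lemma integrable_bounded (g : X -> R) (B : R) E : measurable E ->
  measurable_fun setT g -> (forall x, `|g x| <= B) ->
  P.-integrable E (EFin \o g).
Proof.
move=> mE mg gB; apply: measurable_bounded_integrable => //.
- by rewrite (le_lt_trans (probability_le1 _ _))// ltry.
- exact: measurable_funTS.
- exists B; split; first exact: num_real.
  by move=> M BM x _ /=; rewrite (le_trans (gB x))// ltW.
Qed.

Lemma Rintegral_invariant (g : X -> R) (B : R) E : measurable E ->
  T @^-1` E = E -> measurable_fun setT g -> (forall x, `|g x| <= B) ->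
  \int[P]_(x in E) g (T x) = \int[P]_(x in E) g x.
Proof.
move=> mE TE mg gB; rewrite /Rintegral; congr fine.
have -> : (\int[P]_(x in E) (g x)%:E = \int[pushforward P T]_(x in E) (g x)%:E)%E.
  by apply: eq_measure_integral => A mA _; rewrite -[LHS]PT.
rewrite integral_pushforward//=.
- by rewrite TE.
- exact/measurable_EFinP.
- rewrite TE; apply: (integrable_bounded (g := g \o T) (B := B)) => //.
    exact: measurableT_comp.
  by move=> x; exact: gB.
Qed.

(** Garsia's argument: with M the maximum of the first sums, g is at least
    M - M o T where M > 0, and M - M o T <= 0 elsewhere.  The integral of
    M - M o T over an invariant set is zero, so g has nonnegative integral over
    the part of E where M > 0; this part exhausts E as the number of sums grows. *)
Lemma maximal_ergodic (g : X -> R) (B : R) E : measurable_fun setT g ->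
  (forall x, `|g x| <= B) -> measurable E -> T @^-1` E = E ->
  (forall x, E x -> exists n, 0 < birkhoff_sum g n x) ->
  0 <= \int[P]_(x in E) g x.
Proof.
move=> mg gB mE TE gE.
pose M n := birkhoff_max g n.+1.
have mM n : measurable_fun setT (M n) by exact: measurable_birkhoff_max.
have MB n x : `|M n x| <= n.+1%:R * B.
  by rewrite ger0_norm ?birkhoff_max_ge0// birkhoff_max_bounded.
pose f n x := if 0 < M n x then g x else 0.
have mf n : measurable_fun setT (f n).
  apply: measurable_fun_if => //.
  - exact: measurable_fun_ltr.
  - exact: measurable_funTS.
have fB n x : `|f n x| <= B.
  by rewrite /f; case: ifPn => // _; rewrite normr0 (le_trans _ (gB x)).
have f_ge0 n : 0 <= \int[P]_(x in E) f n x.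
  have -> : 0 = \int[P]_(x in E) (M n x - M n (T x)).
    rewrite RintegralB//; [|exact: integrable_bounded (MB n)|]; last first.
      apply: (integrable_bounded (g := M n \o T) (B := n.+1%:R * B)) => //.
        exact: measurableT_comp.
      by move=> x; exact: MB.
    by rewrite (@Rintegral_invariant (M n) (n.+1%:R * B))// subrr.
  apply: le_Rintegral => //.
  - apply: (integrable_bounded (g := fun x => M n x - M n (T x))
        (B := n.+1%:R * B + n.+1%:R * B)) => //.
      by apply: measurable_funB => //; exact: measurableT_comp.
    by move=> x; rewrite (le_trans (ler_normB _ _))// lerD.
  - exact: integrable_bounded (fB n).
  move=> x _; rewrite /f; case: ifPn => [|]; last first.
    rewrite -leNgt => Mx; rewrite lerBlDr add0r (le_trans Mx)//.
    exact: birkhoff_max_ge0.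
  rewrite lerBlDr {1 2}/M/= lt_max ltxx/= => gM.
  by rewrite (max_idPr (ltW gM)) lerD2l; exact: birkhoff_max_homo.
have intf : (\int[P]_(x in E) (f n x)%:E @[n --> \oo] -->
             \int[P]_(x in E) (g x)%:E)%E.
  have [] := @dominated_convergence _ _ _ P E mE (fun n => EFin \o f n)
     (EFin \o g) (cst B%:E).
  - by move=> n; apply: measurable_funTS; exact/measurable_EFinP.
  - by apply: measurable_funTS; exact/measurable_EFinP.
  - apply: aeW => x Ex; have [n n0] := gE x Ex.
    have n1 k : (n <= k)%N -> f k x = g x.
      move=> nk; rewrite /f ifT// (lt_le_trans n0)//.
      rewrite (le_trans (birkhoff_sum_le_max _ _ _))//.
      have /nondecreasing_seqP mono :
          forall k, birkhoff_max g k x <= birkhoff_max g k.+1 x.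
        by move=> m; exact: birkhoff_max_homo.
      exact/mono/leqW.
    apply: cvg_near_cst; exists n => // k /= nk; by rewrite n1.
  - by apply: (integrable_bounded (g := cst B) (B := `|B|)).
  - by apply: aeW => x k _ /=; rewrite lee_fin.
  - by [].
rewrite /Rintegral fine_ge0// -(cvg_lim _ intf)//.
apply: lime_ge; first exact: (cvgP _ intf).
apply: nearW => n.
have := f_ge0 n; rewrite /Rintegral.
have : (\int[P]_(x in E) (f n x)%:E \is a fin_num)%E.
  by apply: integrable_fin_num => //; exact: integrable_bounded (fB n).
by move=> /fineK <-; rewrite lee_fin.
Qed.

(** This replaces the set where the upper limit of the averages exceeds b: its
    invariance is immediate, as an additive perturbation of the sums is absorbed
    by C. *)
Definition superlinear_sums (g : X -> R) (b : R) : set X :=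
  [set x | forall C : nat, exists n, b * n%:R + C%:R < birkhoff_sum g n x].

Lemma measurable_superlinear_sums g b : measurable_fun setT g ->
  measurable (superlinear_sums g b).
Proof.
move=> mg.
rewrite (_ : superlinear_sums g b = \bigcap_(C : nat) \bigcup_n
    [set x | b * n%:R + C%:R < birkhoff_sum g n x]).
  apply: bigcapT_measurable => C; apply: bigcupT_measurable => n.
  rewrite -[X in measurable X]setTI.
  exact: measurable_fun_ltr (measurable_cst _) (measurable_birkhoff_sum n mg) _ _ _.
apply/seteqP; split => x /=.
  by move=> xb C _; have [n] := xb C; exists n.
by move=> xb C; have [n _ ?] := xb C I; exists n.
Qed.

Lemma superlinear_sums_invariant (g : X -> R) (b B : R) : (forall x, `|g x| <= B) ->
  T @^-1` superlinear_sums g b = superlinear_sums g b.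
Proof.
move=> gB.
have shift_constant (x : X) (C : nat) : exists K : nat, C%:R + `|b| + B <= K%:R.
  exists (Num.bound (C%:R + `|b| + B)).
  by rewrite ltW// archi_boundP// !addr_ge0// (le_trans _ (gB x)).
apply/seteqP; split => x /= xb C; have [K KC] := shift_constant x C.
  have [n nK] := xb K; exists n.+1; rewrite birkhoff_sumS -natr1.
  have := gB x; have := ler_norm b; rewrite ler_norml => ? /andP[? ?].
  by rewrite mulrDr mulr1; lra.
have [[|n]] := xb K.
  by rewrite /birkhoff_sum big_ord0 mulr0 add0r ltNge ler0n.
rewrite birkhoff_sumS -natr1 => nK; exists n; move: nK.
have := gB x; have := ler_norm (- b); rewrite normrN ler_norml => ? /andP[? ?].
by rewrite mulrDr mulr1; lra.
Qed.

Lemma birkhoff_sumB g (b : R) n x :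
  birkhoff_sum (fun y => g y - b) n x = birkhoff_sum g n x - b * n%:R.
Proof. by rewrite /birkhoff_sum sumrB sumr_const card_ord mulr_natr. Qed.

Lemma birkhoff_sumN g n x :
  birkhoff_sum (fun y => - g y) n x = - birkhoff_sum g n x.
Proof. by rewrite /birkhoff_sum sumrN. Qed.

Lemma birkhoff_sum_bounded (g : X -> R) (B : R) n x : (forall x, `|g x| <= B) ->
  `|birkhoff_sum g n x| <= B * n%:R.
Proof.
move=> gB; rewrite (le_trans (ler_norm_sum _ _ _))//.
by rewrite (le_trans (ler_sum _ (fun i _ => gB _)))// sumr_const card_ord mulr_natr.
Qed.

(** The maximal inequality for g - b, whose sums become positive on E. *)
Lemma superlinear_sums_integral (g : X -> R) (b B : R) E : measurable_fun setT g ->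
  (forall x, `|g x| <= B) -> measurable E -> T @^-1` E = E ->
  E `<=` superlinear_sums g b ->
  b * fine (P E) <= \int[P]_(x in E) g x.
Proof.
move=> mg gB mE TE Eb.
have gbB x : `|g x - b| <= B + `|b| by rewrite (le_trans (ler_normB _ _))// lerD2r.
have mgb : measurable_fun setT (fun x => g x - b) by exact: measurable_funB.
have := maximal_ergodic mgb gbB mE TE.
rewrite RintegralB//; [|exact: integrable_bounded gB|]; last first.
  exact: (integrable_bounded (g := cst b) (B := `|b|)).
rewrite Rintegral_cst// subr_ge0; apply => x /Eb /(_ 0%N) [n].
by rewrite addr0 => ?; exists n; rewrite birkhoff_sumB subr_gt0.
Qed.

(** The integral of g over this invariant set is at least b and at most a times
    the measure of the set, which is absurd for a set of positive measure. *)
Lemma superlinear_sums_null (g : X -> R) (a b B : R) : measurable_fun setT g ->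
  (forall x, `|g x| <= B) -> a < b ->
  P (superlinear_sums g b `&` superlinear_sums (fun x => - g x) (- a)) = 0%E.
Proof.
move=> mg gB ab; set E := _ `&` _.
have mNg : measurable_fun setT (fun x => - g x) by exact: measurableT_comp.
have NgB x : `|- g x| <= B by rewrite normrN.
have mE : measurable E by apply: measurableI; exact: measurable_superlinear_sums.
have TE : T @^-1` E = E.
  rewrite preimage_setI (superlinear_sums_invariant _ gB).
  by rewrite (superlinear_sums_invariant _ NgB).
have h1 := superlinear_sums_integral mg gB mE TE (@subIsetl _ _ _).
have h2 := superlinear_sums_integral mNg NgB mE TE (@subIsetr _ _ _).
have PE : P E \is a fin_num by exact: fin_num_measure.
have : \int[P]_(x in E) - g x = - \int[P]_(x in E) g x.
  under eq_Rintegral do rewrite -mulN1r.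
  by rewrite RintegralZl ?mulN1r//; exact: integrable_bounded gB.
move=> h3; rewrite h3 mulNr lerN2 in h2.
have p0 : 0 <= fine (P E) by rewrite fine_ge0.
have : fine (P E) = 0.
  apply/eqP; rewrite eq_le p0 andbT.
  have : b * fine (P E) <= a * fine (P E) by exact: le_trans h2.
  by rewrite -subr_ge0 -mulrBl nmulr_rge0// subr_lt0.
by move=> PE0; rewrite -(fineK PE) PE0.
Qed.

End birkhoff.

(** The limit is the supremum of the slopes b for which s n - b n is unbounded
    above.  Any larger slope dominates s up to a constant, and by hypothesis any
    smaller slope is dominated by s up to a constant. *)
Lemma cvg_averages (R : realType) (s : nat -> R) (B : R) :
  (forall n, `|s n| <= B * n%:R) ->
  (forall a b, a < b ->
    (forall C : nat, exists n, b * n%:R + C%:R < s n) ->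
    ~ (forall C : nat, exists n, - a * n%:R + C%:R < - s n)) ->
  cvgn (fun n => n%:R^-1 * s n).
Proof.
move=> sB sab; pose G := [set b : R | forall C : nat, exists n, b * n%:R + C%:R < s n].
have supG : has_sup G.
  split.
    exists (- B - 1) => C; exists C.+1.
    by have := sB C.+1; rewrite ler_norml -natr1 => /andP[]; lra.
  exists B => b /(_ 0%N)[n]; rewrite addr0 leNgt => bn; apply/negP => Bb.
  have := sB n; rewrite ler_norml => /andP[_]; rewrite leNgt => /negP; apply.
  by rewrite (le_lt_trans _ bn)// ler_wpM2r// ltW.
have upper (e : R) : 0 < e -> exists C : nat, forall n, s n <= (sup G + e) * n%:R + C%:R.
  move=> e0; have : ~ G (sup G + e).
    by move=> /(ub_le_sup supG.2); rewrite leNgt ltrDl e0.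
  move=> /existsNP[C] /forallNP CG; exists C => n.
  by have /negP := CG n; rewrite -leNgt.
have lower (e : R) : 0 < e -> exists C : nat, forall n, (sup G - e) * n%:R - C%:R <= s n.
  move=> e0; have [b Gb bG] := sup_adherent e0 supG.
  have /existsNP[C /forallNP CG] := sab _ _ bG Gb; exists C => n.
  by have /negP := CG n; rewrite -leNgt; lra.
apply/cvg_ex; exists (sup G); apply/cvgrPdist_le => e e0.
have e20 : 0 < e / 2 by rewrite divr_gt0.
have [C sC] := upper _ e20; have [D sD] := lower _ e20.
pose N := (Num.bound ((C + D)%:R / (e / 2))).+1.
exists N => // n /= Nn.
have n0 : 0 < n%:R :> R by rewrite ltr0n (leq_trans _ Nn).
have CDn : C%:R + D%:R <= e / 2 * n%:R.
  rewrite -natrD mulrC -ler_pdivrMr// (le_trans (ltW (archi_boundP _)))//.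
    by rewrite divr_ge0// ltW.
  by rewrite ler_nat (leq_trans _ Nn).
have C0 : 0 <= C%:R :> R by [].
have D0 : 0 <= D%:R :> R by [].
rewrite ler_distl; apply/andP; split.
  rewrite lerBlDr ler_pdivrMl//; have := sC n; lra.
rewrite -lerBlDr ler_pdivlMl//; have := sD n; lra.
Qed.

Theorem birkhoff_ergodic d (X : measurableType d) (R : realType)
    (P : probability X R) (T : X -> X) (g : X -> R) (B : R) :
  measurable_fun setT T ->
  (forall E, measurable E -> P (T @^-1` E) = P E) ->
  measurable_fun setT g -> (forall x, `|g x| <= B) ->
  {ae P, forall x, cvgn (fun n => n%:R^-1 * birkhoff_sum T g n x)}.
Proof.
move=> mT PT mg gB.
(* Rational slopes suffice, as being superlinear persists when the slope b
   decreases; this makes the exceptional set a countable union. *)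
pose bad (q : rat * rat) := if q.1 < q.2 then
  superlinear_sums T g (ratr q.2) `&`
  superlinear_sums T (fun x => - g x) (- ratr q.1) else set0.
have badN q : P.-negligible (bad q).
  rewrite /bad; case: ifPn => // q12; last exact: negligible_set0.
  apply/negligibleP.
    apply: measurableI; apply: measurable_superlinear_sums => //.
    exact: measurableT_comp.
  by apply: superlinear_sums_null mg gB _ => //; rewrite ltr_rat.
have : P.-negligible (\bigcup_(n : nat) (if unpickle n is Some q then bad q else set0)).
  apply: negligible_bigcup => n; case: unpickle => [q|]; first exact: badN.
  exact: negligible_set0.
apply: negligibleS => x; apply: contra_notP => xN.
apply: (@cvg_averages _ _ B); first by move=> n; exact: birkhoff_sum_bounded.
move=> a b ab xb xa; apply: xN.
have [q1] := rat_in_itvoo ab; rewrite in_itv/= => /andP[aq1 q1b].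
have [q2] := rat_in_itvoo q1b; rewrite in_itv/= => /andP[q12 q2b].
exists (pickle (q1, q2)); first exact: I.
rewrite pickleK /bad/= ifT; last by rewrite -(ltr_rat R).
split=> C.
  have [n xn] := xb C; exists n; rewrite (le_lt_trans _ xn)// lerD2r ler_wpM2r// ltW//.
have [n xn] := xa C; exists n; rewrite birkhoff_sumN (le_lt_trans _ xn)//.
by rewrite lerD2r ler_wpM2r// lerN2 ltW.
Qed.

(** * The pointwise ergodic theorem in continuous time *)

Section translation.
Context (R : realType).
Local Notation leb := (@lebesgue_measure R).

Lemma measurable_translation (c : R) :
  measurable_fun setT (fun t : measurableTypeR R => t + c : measurableTypeR R).
Proof. exact: measurable_funD. Qed.

Lemma lebesgue_measure_translation (c : R) (A : set (measurableTypeR R)) :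
  measurable A -> leb ((fun t => t + c) @^-1` A) = leb A.
Proof.
move=> mA; have mc := measurable_translation c.
transitivity (pushforward leb
  (fun t : measurableTypeR R => t + c : measurableTypeR R) A) => //.
apply/esym/lebesgue_measure_unique => //= _ [[a b]] _ <-.
rewrite /pushforward /=.
rewrite (_ : (fun t => t + c) @^-1` `]a, b] = `]a - c, b - c]%classic).
  rewrite !lebesgue_measure_itv/= !lte_fin ltrD2r; case: ifPn => // _.
  by rewrite -!EFinB; congr EFin; ring.
by apply/seteqP; split => t /=; rewrite !in_itv/= ltrBlDr lerBrDr.
Qed.

Lemma Rintegral_translation (h : R -> R) (a b c : R) :
  measurable_fun setT h -> (forall t, 0 <= h t) ->
  \int[leb]_(t in `[a + c, b + c]) h t = \int[leb]_(t in `[a, b]) h (t + c).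
Proof.
move=> mh h0; rewrite /Rintegral; congr fine.
have mc := measurable_translation c.
pose tr : measurableTypeR R -> measurableTypeR R := fun t => t + c.
transitivity (\int[pushforward leb tr]_(t in `[(a + c)%R, (b + c)%R]) (h t)%:E)%E.
  by apply: eq_measure_integral => A mA _; exact/esym/(lebesgue_measure_translation c mA).
rewrite ge0_integral_pushforward//=.
- congr integral.
  by apply/seteqP; split => t /=; rewrite !in_itv/= !lerD2r.
- by apply/measurable_EFinP; exact: measurable_funTS.
- by move=> t _; rewrite lee_fin.
Qed.

End translation.

Section unit_interval_integrals.
Context (R : realType).
Local Notation leb := (@lebesgue_measure R).
Variable h : R -> R.
Hypotheses (mh : measurable_fun setT h) (h01 : forall t, 0 <= h t <= 1).

Lemma integrable_itvcc (a b : R) : leb.-integrable `[a, b] (EFin \o h).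
Proof.
apply: measurable_bounded_integrable => //.
- by rewrite /= lebesgue_measure_itv/=; case: ifP => // _; rewrite -EFinB ltry.
- exact: measurable_funTS.
- exists 1; split=> // M M1 x _ /=; have /andP[h0 h1] := h01 x.
  by rewrite ger0_norm// (le_trans h1)// ltW.
Qed.

Lemma Rintegral_incr (s t : R) : 0 <= s <= t ->
  \int[leb]_(x in `[0, t]) h x =
    \int[leb]_(x in `[0, s]) h x + \int[leb]_(x in `[s, t]) h x.
Proof.
move=> /andP[s0 st]; apply/eqP; rewrite addrC -subr_eq; apply/eqP.
rewrite Rintegral_itvB//; [|exact: integrable_itvcc].
rewrite Rintegral_itv_obnd_cbnd//.
apply: integrableS (integrable_itvcc s t) => //.
by apply: subset_itvr; rewrite bnd_simp.
Qed.

Lemma Rintegral_itvcc_bounds (s t : R) : s <= t ->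
  0 <= \int[leb]_(x in `[s, t]) h x <= t - s.
Proof.
move=> st; rewrite Rintegral_ge0/=; last by move=> x _; case/andP: (h01 x).
apply: (@le_trans _ _ (\int[leb]_(x in `[s, t]) 1)).
  apply: le_Rintegral => //; first exact: integrable_itvcc.
    apply: measurable_bounded_integrable => //.
      by rewrite /= lebesgue_measure_itv/=; case: ifP => // _; rewrite -EFinB ltry.
    by exists 1; split => // M M1 x _ /=; rewrite normr1 ltW.
  by move=> x _; case/andP: (h01 x).
rewrite Rintegral_cst//= lebesgue_measure_itv/= lte_fin mul1r.
by case: ifPn => [_//|]; rewrite -leNgt /= => ts; rewrite subr_ge0.
Qed.

(** Rounding t down to an integer changes the integral by at most 1, hence the
    average by a quantity of order 1 / t. *)
Lemma cvg_time_average_nat :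
  cvgn (fun n => n%:R^-1 * \int[leb]_(x in `[0, n%:R]) h x) ->
  cvg ((fun t => t^-1 * \int[leb]_(x in `[0, t]) h x) @ +oo).
Proof.
move=> /cvg_ex[l Il]; apply/cvg_ex; exists l; apply/cvgrPdist_le => e e0.
move/cvgrPdist_le : Il => /(_ (e / 2)) [|N _ NI]; first by rewrite divr_gt0.
near=> t.
have t0 : 0 < t by near: t; apply: nbhs_pinfty_gt; exact: num_real.
have te : 4 / e <= t by near: t; apply: nbhs_pinfty_ge; exact: num_real.
have Nt : N.+1%:R <= t by near: t; apply: nbhs_pinfty_ge; exact: num_real.
have /andP[nt tn] := truncn_itv (ltW t0).
set n := Num.truncn t in nt tn.
have Nn : (N < n)%N by rewrite -ltnS -(ltr_nat R) (le_lt_trans _ tn).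
have n0 : 0 < n%:R :> R by rewrite ltr0n (leq_ltn_trans _ Nn).
have {}NI := NI n (ltnW Nn).
have := @Rintegral_incr n%:R t; rewrite ltW//= => /(_ nt) ->.
have /andP[J0 J1] := Rintegral_itvcc_bounds nt.
have /andP[I0 I1] := Rintegral_itvcc_bounds (ltW n0).
move: (\int[leb]_(x in `[0, n%:R]) h x) (\int[leb]_(x in `[n%:R, t]) h x)
  NI J0 J1 I0 I1 => I J NI J0 J1 I0 I1.
have -> : l - t^-1 * (I + J) =
    (l - n%:R^-1 * I) + (t^-1 * (n%:R^-1 * I * (t - n%:R)) - t^-1 * J).
  by field; rewrite !gt_eqF.
rewrite (splitr e) (le_trans (ler_normD _ _))// lerD//.
rewrite -mulrBr normrM gtr0_norm ?invr_gt0// ler_pdivrMl//.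
have II : 0 <= n%:R^-1 * I <= 1.
  by rewrite mulr_ge0 ?invr_ge0 ?(ltW n0)//= ler_pdivrMl// mulr1 -[leRHS]subr0.
have tn1 : t - n%:R <= 1 by move: tn; rewrite -natr1; lra.
have : 2 <= t * (e / 2) by move: te; rewrite ler_pdivrMr//; lra.
move: (n%:R^-1 * I) II => a /andP[a0 a1] e2.
rewrite ler_norml; apply/andP; split; nra.
Unshelve. all: by end_near. Qed.

End unit_interval_integrals.

(** The Birkhoff sums under T of the integral of g over [0, 1] are the integrals
    of g over [0, n], by the translation invariance of Lebesgue measure. *)
Theorem birkhoff_ergodic_continuous d (X : measurableType d) (R : realType)
    (P : probability X R) (T : X -> X) (g : R -> X -> R) :
  measurable_fun setT T ->
  (forall E, measurable E -> P (T @^-1` E) = P E) ->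
  measurable_fun setT (fun p : measurableTypeR R * X => g p.1 p.2) ->
  (forall t x, 0 <= g t x <= 1) ->
  (forall t x, 0 <= t -> g (t + 1) x = g t (T x)) ->
  {ae P, forall x, cvg ((fun t => t^-1 *
     \int[@lebesgue_measure R]_(s in `[0, t]) g s x) @ +oo)}.
Proof.
move=> mT PT mg g01 gT.
have mgx x : measurable_fun setT (g^~ x).
  exact: (measurableT_comp mg (@measurable_pair2 _ _ _ _ _)).
pose F x := \int[@lebesgue_measure R]_(s in `[0, 1]) g s x.
have mF : measurable_fun setT F.
  apply: (measurableT_comp (fine_measurable measurableT)).
  pose f (p : measurableTypeR R * X) : \bar R := (g p.1 p.2 * \1_`[0, 1] p.1)%:E.
  have mf : measurable_fun setT f.
    apply/measurable_EFinP; apply: measurable_funM => //.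
    exact: (measurableT_comp (measurable_indic _) (@measurable_fst _ _ _ _)).
  have f0 p : (0 <= f p)%E by rewrite lee_fin mulr_ge0//; case/andP: (g01 p.1 p.2).
  have := measurable_fun_fubini_tonelli_G (m1 := @lebesgue_measure R) f mf f0.
  congr measurable_fun; apply/funext => x; rewrite [RHS]integral_mkcond.
  apply: eq_integral => t _; rewrite /f patchE indicE/=.
  by case: ifPn => _; rewrite ?mulr1 ?mulr0.
have F1 x : `|F x| <= 1.
  have := Rintegral_itvcc_bounds (mgx x) (g01^~ x) (@ler01 R).
  by rewrite subr0 => /andP[? ?]; rewrite ger0_norm.
have := birkhoff_ergodic mT PT mF F1.
apply: filterS => x.
have -> : (fun n => n%:R^-1 * birkhoff_sum T F n x) =
    (fun n => n%:R^-1 * \int[@lebesgue_measure R]_(s in `[0, n%:R]) g s x).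
  apply/funext => n; congr (_ * _).
  elim: n x => [x|n IH x].
    by rewrite /birkhoff_sum big_ord0 set_itv1 Rintegral_set1.
  rewrite birkhoff_sumS IH [RHS](@Rintegral_incr _ _ (mgx x) (g01^~ x) 1)//; last first.
    by rewrite ler01 ler1n.
  congr (_ + _).
  have := @Rintegral_translation R (g^~ x) 0 n%:R 1 (mgx x) _.
  rewrite add0r natr1 => ->; last by move=> t; case/andP: (g01 t x).
  by apply: eq_Rintegral => s; rewrite inE/= in_itv/= => /andP[s0 _]; rewrite gT.
exact: cvg_time_average_nat.
Qed.

(** * The inner product of square integrable fields *)

Section square_integrable_fields.
Context (R : realType) (Omega : smooth_domain R).
Local Notation dx := (dx Omega).
Local Notation inner := (inner Omega).
Local Notation norm2 := (norm2 Omega).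

Definition sqint (F : field R) := forall i, (F i : R3m R -> R) \in Lfun dx 2%:E.

Lemma sqint_rep (u : L2field Omega) : sqint (rep u).
Proof.
move=> i; rewrite inE; apply/andP; split; rewrite inE/=.
  exact: (measurable_funPT (repr (u i : {mfun_ dx, R3m R >-> measurableTypeR R}))).
exact: (@Lebesgue_finite _ _ _ _ _ _ (u i)).
Qed.

Lemma sqint_lin (a : R) F G : sqint F -> sqint G ->
  sqint (fun i x => a * F i x + G i x).
Proof.
move=> sF sG i.
exact: ((Lfun_submod_closed dx (lee1n 2)).2 a _ _ (sF i) (sG i)).
Qed.

Lemma sqintB F G : sqint F -> sqint G -> sqint (fun i x => F i x - G i x).
Proof.
move=> sF sG; rewrite (_ : (fun i x => _) = (fun i x => -1 * G i x + F i x)).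
  exact: sqint_lin.
by apply/funext => i; apply/funext => x; rewrite mulN1r addrC.
Qed.

Lemma sqint_mul_integrable F G i : sqint F -> sqint G ->
  dx.-integrable setT (EFin \o (fun x => F i x * G i x)).
Proof. by move=> sF sG; apply/Lfun1_integrable; exact: Lfun2_mul_Lfun1. Qed.

Lemma innerC F G : inner F G = inner G F.
Proof.
by apply: eq_bigr => i _; apply: eq_Rintegral => x _; rewrite mulrC.
Qed.

Lemma inner_linl (a : R) F G K : sqint F -> sqint G -> sqint K ->
  inner (fun i x => a * F i x + G i x) K = a * inner F K + inner G K.
Proof.
move=> sF sG sK; rewrite /inner mulr_sumr -big_split/=; apply: eq_bigr => i _.
rewrite -RintegralZl//; last exact: sqint_mul_integrable.
rewrite -RintegralD//.
- by apply: eq_Rintegral => x _; rewrite mulrDl mulrA.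
- exact: (integrableZl measurableT a (sqint_mul_integrable i sF sK)).
- exact: sqint_mul_integrable.
Qed.

Lemma inner_linr (a : R) F G K : sqint F -> sqint G -> sqint K ->
  inner K (fun i x => a * F i x + G i x) = a * inner K F + inner K G.
Proof. by move=> *; rewrite innerC inner_linl// ![inner _ K]innerC. Qed.

Lemma inner_ae F F' G : sqint F -> sqint F' -> sqint G ->
  (forall i, {ae dx, forall x, F i x = F' i x}) -> inner F G = inner F' G.
Proof.
move=> sF sF' sG FF'; apply: eq_bigr => i _; rewrite /Rintegral; congr fine.
apply: ae_eq_integral => //.
- exact: (measurable_int dx (sqint_mul_integrable i sF sG)).
- exact: (measurable_int dx (sqint_mul_integrable i sF' sG)).
- have := FF' i; apply: filterS; first exact: (ae_filter_ringOfSetsType dx).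
  by move=> x /= -> _.
Qed.

Lemma norm2_ge0 F : 0 <= norm2 F.
Proof.
by rewrite sumr_ge0// => i _; apply: Rintegral_ge0 => x _; rewrite -expr2 sqr_ge0.
Qed.

Lemma norm2_lin (a : R) F G : sqint F -> sqint G ->
  norm2 (fun i x => a * F i x + G i x) =
  a ^+ 2 * norm2 F + 2 * a * inner F G + norm2 G.
Proof.
move=> sF sG; have sFG := sqint_lin a sF sG.
rewrite {1}/norm2 inner_linl// !inner_linr// [inner G F]innerC /norm2; ring.
Qed.

Lemma norm2B F G : sqint F -> sqint G ->
  norm2 (fun i x => F i x - G i x) = norm2 F - 2 * inner F G + norm2 G.
Proof.
move=> sF sG.
rewrite (_ : (fun i x => _) = (fun i x => -1 * G i x + F i x)).
  by rewrite norm2_lin// [inner G F]innerC; ring.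
by apply/funext => i; apply/funext => x; rewrite mulN1r addrC.
Qed.

(** Expand the squares of e^-1 F + G and of - e^-1 F + G.  The free parameter e
    makes this a substitute for the Cauchy-Schwarz inequality that also covers
    the case of F of norm zero. *)
Lemma inner_young (e : R) F G : sqint F -> sqint G -> 0 < e ->
  2 * `|inner F G| <= e^-1 * norm2 F + e * norm2 G.
Proof.
move=> sF sG e0.
have := norm2_ge0 (fun i x => e^-1 * F i x + G i x).
have := norm2_ge0 (fun i x => - e^-1 * F i x + G i x).
rewrite !norm2_lin// => h2 h1.
have {h1} h1 := mulr_ge0 (ltW e0) h1; have {h2} h2 := mulr_ge0 (ltW e0) h2.
have en0 : e != 0 by rewrite gt_eqF.
have E1 : e * ((- e^-1) ^+ 2 * norm2 F + 2 * - e^-1 * inner F G + norm2 G) =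
    e^-1 * norm2 F - 2 * inner F G + e * norm2 G by field.
have E2 : e * (e^-1 ^+ 2 * norm2 F + 2 * e^-1 * inner F G + norm2 G) =
    e^-1 * norm2 F + 2 * inner F G + e * norm2 G by field.
rewrite E1 in h2; rewrite E2 in h1.
by rewrite -[2]gtr0_norm// -normrM ler_norml; apply/andP; split; lra.
Qed.

(** Young's inequality with e the norm of F, or e tending to zero when this norm
    vanishes. *)
Lemma inner_bounded F G : sqint F -> sqint G ->
  `|inner F G| <= (1 + norm2 G) / 2 * Num.sqrt (norm2 F).
Proof.
move=> sF sG; have := norm2_ge0 F; rewrite le_eqVlt => /predU1P[F0|F0].
  rewrite -F0 sqrtr0 mulr0; apply/ler_addgt0Pr => e e0; rewrite add0r.
  have G0 := norm2_ge0 G; have e0' : 0 < e / (1 + norm2 G) by rewrite divr_gt0// ltr_pwDl.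
  have := inner_young sF sG e0'; rewrite -F0 mulr0 add0r => h.
  have : e / (1 + norm2 G) * norm2 G <= e.
    by rewrite mulrAC ler_pdivrMr ?ltr_pwDl// ler_wpM2l ?ltW// ltr_pwDl.
  have : 0 <= `|inner F G| by []. lra.
have s0 : 0 < Num.sqrt (norm2 F) by rewrite sqrtr_gt0.
have := inner_young sF sG s0.
rewrite -{2}(sqr_sqrtr (ltW F0)) expr2 mulrA mulVf ?gt_eqF// mul1r => h; lra.
Qed.

End square_integrable_fields.

(** * A countable family of step fields approximating test fields *)

Lemma measurable_truncn_preimage (R : realType) (B : set nat) :
  measurable ((@Num.truncn R) @^-1` B : set (measurableTypeR R)).
Proof.
have mle m : measurable [set y : measurableTypeR R | (Num.truncn (y : R) <= m)%N].
  rewrite (_ : [set y | _] = `]-oo, m.+1%:R[%classic).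
    exact: measurable_itv.
  by apply/seteqP; split => y /=; rewrite in_itv/= truncn_le_nat.
have -> : (@Num.truncn R) @^-1` B = \bigcup_(m in B)
    ([set y : R | (Num.truncn y <= m)%N] `\` [set y : R | (Num.truncn y < m)%N]).
  apply/seteqP; split => [y By|y [m Bm /= [ym /negP ny]]].
    by exists (Num.truncn y) => //=; rewrite leqnn ltnn.
  suff -> : Num.truncn y = m by [].
  by apply/eqP; rewrite eqn_leq ym leqNgt.
apply: bigcup_measurable => m _; apply: measurableD; first exact: mle.
case: m => [|m]; last exact: mle.
by rewrite (_ : [set y : R | _] = set0)//; apply/seteqP; split.
Qed.

Section measurable_rays.
Context d (T : measurableType d) (R : realType) (f : T -> R).

Lemma measurable_fun_ltP : (forall c, measurable [set x | f x < c]) ->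
  measurable_fun setT f.
Proof.
move=> mf mT; apply: (measurability _ (RGenInftyO.measurableE R)) => //.
move=> _ [_ [c ->] <-]; rewrite setTI (_ : _ @^-1` _ = [set x | f x < c])//.
Qed.

Lemma measurable_fun_leP : (forall c, measurable [set x | f x <= c]) ->
  measurable_fun setT f.
Proof.
move=> mf mT; apply: (measurability _ (RGenOInfty.measurableE R)) => //.
move=> _ [_ [c ->] <-]; rewrite setTI (_ : _ @^-1` _ = ~` [set x | f x <= c]).
  exact: measurableC.
by apply/seteqP; split => x /=; rewrite in_itv/= andbT ltNge => /negP.
Qed.

End measurable_rays.

Section grids.
Variable R : realType.

(** The cube [- n, n]^3 is cut into cells of side 1 / (n + 1), the cell of a
    point being given by three indices below [grid_size n]. *)
Definition grid_size (n : nat) := (2 * n * n.+1)%N.+1.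

Definition grid_index (n : nat) (y : R) : 'I_(grid_size n) :=
  inord (Num.truncn ((y + n%:R) * n.+1%:R)).

Definition grid_point (n : nat) (a : 'I_(grid_size n)) : R :=
  a%:R / n.+1%:R - n%:R.

Lemma grid_point_dist n y : `|y| <= n%:R ->
  `|grid_point (grid_index n y) - y| <= n.+1%:R^-1.
Proof.
rewrite ler_norml => /andP[y0 y1].
have n0 : 0 < n.+1%:R :> R by [].
have z0 : 0 <= (y + n%:R) * n.+1%:R by rewrite mulr_ge0//; lra.
have /andP[tz zt] := truncn_itv z0.
rewrite /grid_point /grid_index inordK; last first.
  rewrite ltnS -(ler_nat R) (le_trans tz)// !natrM ler_wpM2r//; lra.
set a := Num.truncn _ in tz zt *.
have -> : a%:R / n.+1%:R - n%:R - y = (a%:R - (y + n%:R) * n.+1%:R) / n.+1%:R.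
  by field.
rewrite normrM (gtr0_norm (x := _^-1)) ?invr_gt0// ler_piMl ?invr_ge0//.
rewrite -natr1 in zt; rewrite ler_norml; apply/andP; split; lra.
Qed.

Lemma measurable_grid_index n (B : set 'I_(grid_size n)) :
  measurable (grid_index n @^-1` B : set (measurableTypeR R)).
Proof.
have mz : measurable_fun setT
    (fun y : measurableTypeR R => (y + n%:R) * n.+1%:R : measurableTypeR R).
  by apply: measurable_funM => //; exact: measurable_funD.
have := mz measurableT _ (@measurable_truncn_preimage R ((fun m => inord m) @^-1` B)).
by rewrite setTI.
Qed.

(** A step field is encoded by a mesh parameter and a finite table of rationals,
    so that there are countably many of them.  Points off the cube read
    arbitrary entries of the table. *)
Definition grid_code :=
  {n : nat & {ffun 'I_3 * 'I_(grid_size n) * 'I_(grid_size n) * 'I_(grid_size n) -> rat}}.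

Definition step_field (k : grid_code) : field R := fun i x =>
  ratr (projT2 k (i, grid_index _ x.1.1, grid_index _ x.1.2, grid_index _ x.2)).

Lemma measurable_step_field k i :
  measurable_fun setT (step_field k i : R3m R -> measurableTypeR R).
Proof.
case: k => n f _ Y mY; rewrite setTI.
pose val (c : 'I_(grid_size n) * 'I_(grid_size n) * 'I_(grid_size n)) : R :=
  ratr (f (i, c.1.1, c.1.2, c.2)).
have -> : step_field (existT _ n f) i @^-1` Y = \bigcup_(c in val @^-1` Y)
    ((grid_index n @^-1` [set c.1.1]) `*` (grid_index n @^-1` [set c.1.2])
      `*` (grid_index n @^-1` [set c.2])).
  apply/seteqP; split => [[[x1 x2] x3] Yx|[[x1 x2] x3] /= [[[a b] c]] /= Yc].
    by exists (grid_index n x1, grid_index n x2, grid_index n x3).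
  by move=> [[xa xb] xc]; move: Yc; rewrite /step_field/= /val/= xa xb xc.
rewrite bigcup_mkcond; apply: countable_bigcupT_measurable => [|c].
  exact: countableP.
case: ifPn => // _.
by apply: measurableX; [apply: measurableX|]; exact: measurable_grid_index.
Qed.

Lemma step_field_bounded k : exists M, forall i x, `|step_field k i x| <= M.
Proof.
case: k => n f; exists (\sum_c `|ratr (f c)|) => i x.
rewrite /step_field/=; set c := (i, _, _, _).
by rewrite (bigD1 c)//= lerDl sumr_ge0.
Qed.

End grids.

Section density.
Context (R : realType) (Omega : smooth_domain R).
Local Notation dx := (dx Omega).
Local Notation norm2 := (norm2 Omega).

Lemma domain_coordinates : exists n : nat, forall x, domain_set Omega x ->
  [/\ `|x.1.1| <= n%:R, `|x.1.2| <= n%:R & `|x.2| <= n%:R].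
Proof.
have [M [_ MO]] := domain_bounded Omega.
exists (Num.bound `|M + 1|) => x Ox.
have := MO (M + 1) _ x Ox; rewrite ltrDl ltr01 => /(_ isT) xM.
have xn : `|x| <= (Num.bound `|M + 1|)%:R.
  by rewrite (le_trans xM)// (le_trans (ler_norm _))// ltW// archi_boundP.
move: xn; case: x {Ox xM} => -[x1 x2] x3.
by rewrite !prod_normE/= !ge_max => /andP[/andP[? ?] ?].
Qed.

Lemma dx_finite : (dx setT < +oo)%E.
Proof.
have [n nO] := domain_coordinates.
pose I : set (measurableTypeR R) := `[- n%:R, n%:R]%classic.
have mI : measurable I by exact: measurable_itv.
have Vol : volume R ((I `*` I) `*` I) =
    (@lebesgue_measure R I * @lebesgue_measure R I * @lebesgue_measure R I)%E.
  transitivity ((@lebesgue_measure R \x @lebesgue_measure R) (I `*` I) *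
    @lebesgue_measure R I)%E.
    by apply: product_measure1E => //; exact: measurableX.
  by congr (_ * _)%E; exact: product_measure1E.
have : (dx setT <= volume R ((I `*` I) `*` I))%E.
  rewrite /Defs.dx /= /mrestr setTI; apply: le_measure; rewrite ?inE.
  - exact: open_measurable3 (domain_open _).
  - by apply: measurableX => //; exact: measurableX.
  - by move=> -[[x1 x2] x3] /nO[/= ? ? ?]; rewrite /I/= !in_itv/= -!ler_norml.
move=> /le_lt_trans; apply; rewrite Vol.
have -> : @lebesgue_measure R I = (n%:R + n%:R)%:E.
  rewrite /I lebesgue_measure_itv/= lte_fin; case: ifPn => [_|].
    by rewrite -EFinB opprK.
  by rewrite -leNgt => n0; congr EFin; have : 0 <= n%:R :> R by []; lra.
by rewrite -!EFinM ltry.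
Qed.

Lemma sqint_bounded (F : field R) (M : R) :
  (forall i, measurable_fun setT (F i : R3m R -> measurableTypeR R)) ->
  (forall i x, `|F i x| <= M) -> sqint Omega F.
Proof.
move=> mF FM i; rewrite inE; apply/andP; split; rewrite inE//=; first exact: mF.
have mFi : measurable_fun setT (fun x : R3m R => `|(F i x)%:E|%E).
  by apply: measurableT_comp => //; apply/measurable_EFinP; exact: mF.
rewrite /finite_norm unlock /Lnorm poweR_lty//.
apply: (@le_lt_trans _ _ (\int[dx]_x (M `^ 2)%:E)%E).
  apply: ge0_le_integral => //.
  - by move=> x _; exact: poweR_ge0.
  - exact: (measurableT_comp (measurable_poweR 2) mFi).
  - by move=> x _; rewrite /= lee_fin ge0_ler_powR// ?nnegrE// (le_trans _ (FM i x)).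
rewrite integral_cst// lte_mul_pinfty// ?lee_fin ?powR_ge0//.
exact: dx_finite.
Qed.

Lemma test_function_bounded (g : R3 R -> R) : test_function Omega g ->
  exists M, forall x, `|g x| <= M.
Proof.
move=> [/(_ [::])[/= cg _] [K [cK _ gK]]].
have := @continuous_compact _ _ g K (continuous_subspaceT cg) cK.
move=> /compact_bounded[M [_ MK]]; exists `|M + 1| => x.
have [Kx|/gK->] := pselect (K x); last by rewrite normr0.
apply: le_trans (ler_norm _); apply: (MK (M + 1)); first by rewrite ltrDl.
by exists x.
Qed.

Lemma measurable_continuous3 (g : R3 R -> R) : continuous g ->
  measurable_fun setT (g : R3m R -> measurableTypeR R).
Proof.
move=> cg; apply: measurable_fun_ltP => c; apply: open_measurable3.
rewrite (_ : [set x | _] = g @^-1` [set y | y < c])//.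
apply: open_comp => //; exact: open_lt.
Qed.

Lemma sqint_step_field k : sqint Omega (step_field k).
Proof.
have [M kM] := @step_field_bounded R k.
apply: (sqint_bounded (M := M)) => // i; exact: measurable_step_field.
Qed.

Lemma sqint_test_field phi : test_field Omega phi -> sqint Omega phi.
Proof.
move=> tphi; have /choice[M MP] : forall i, exists M, forall x, `|phi i x| <= M.
  by move=> i; apply: test_function_bounded; exact: tphi.
apply: (sqint_bounded (M := \sum_i `|M i|)).
  by move=> i; apply: measurable_continuous3; have [/(_ [::])[]] := tphi i.
move=> i x; rewrite (le_trans (MP i x))// (le_trans (ler_norm _))//.
by rewrite (bigD1 i)//= lerDl sumr_ge0.
Qed.

Lemma ae_domain (Q : R3 R -> Prop) :
  (forall x, domain_set Omega x -> Q x) -> {ae dx, forall x, Q x}.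
Proof.
move=> OQ; exists (~` (domain_set Omega)); split.
- by apply: measurableC; exact: open_measurable3 (domain_open _).
- by rewrite /= /mrestr setICl measure0.
- by move=> x /= nQ Ox; apply: nQ; exact: OQ.
Qed.

(** Sampling phi at grid points and rounding the samples to rationals gives step
    fields that converge pointwise to phi on the domain, with a uniform bound;
    the domain has finite volume, so dominated convergence applies. *)
Lemma step_field_dense phi (e : R) : test_field Omega phi -> 0 < e ->
  exists k, norm2 (fun i x => phi i x - step_field k i x) < e.
Proof.
move=> tphi e0.
have qP n (y : R) : exists q : rat, `|ratr q - y| <= n.+1%:R^-1.
  have [|q] := @rat_in_itvoo R y (y + n.+1%:R^-1); first by rewrite ltrDl.
  rewrite in_itv/= => /andP[yq qy]; exists q.
  have : 0 < n.+1%:R^-1 :> R by rewrite invr_gt0.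
  move: n.+1%:R^-1 qy => h qy h0.
  by rewrite ler_norml; apply/andP; split; lra.
pose q n y := projT1 (cid (qP n y)).
have qE n y : `|ratr (q n y) - y| <= n.+1%:R^-1 by rewrite /q; case: cid.
pose f n : {ffun 'I_3 * 'I_(grid_size n) * 'I_(grid_size n) * 'I_(grid_size n) -> rat} :=
  [ffun c => q n (phi c.1.1.1
    (grid_point R c.1.1.2, grid_point R c.1.2, grid_point R c.2))].
pose k n : grid_code := existT _ n (f n).
pose sample n (x : R3 R) : R3 R := (grid_point R (grid_index n x.1.1),
  grid_point R (grid_index n x.1.2), grid_point R (grid_index n x.2)).
have kE n i x : `|step_field (k n) i x - phi i (sample n x)| <= n.+1%:R^-1.
  by rewrite /step_field/= ffunE/=; exact: qE.
have inv0 : n.+1%:R^-1 @[n --> \oo] --> (0 : R) by exact: cvg_harmonic.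
have kcvg i x : domain_set Omega x -> step_field (k n) i x @[n --> \oo] --> phi i x.
  move=> Ox.
  have grid_cvg (L : nat) (y : R) : `|y| <= L%:R ->
      grid_point R (grid_index n y) @[n --> \oo] --> y.
    move=> yL; apply/cvgrPdist_le => r r0.
    move/cvgrPdist_le : inv0 => /(_ r r0)[N _ Nr].
    exists (maxn N L) => // n /=; rewrite geq_max => /andP[Nn Ln].
    rewrite distrC (le_trans (grid_point_dist _))//.
      by rewrite (le_trans yL)// ler_nat.
    by have := Nr n Nn; rewrite sub0r normrN ger0_norm// invr_ge0.
  have sample_cvg : sample n x @[n --> \oo] --> x.
    have [L LO] := domain_coordinates; have [x1 x2 x3] := LO x Ox.
    case: x x1 x2 x3 {Ox} => -[x1 x2] x3 /= h1 h2 h3.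
    exact: (cvg_pair (cvg_pair (grid_cvg L x1 h1) (grid_cvg L x2 h2)) (grid_cvg L x3 h3)).
  have phi_cvg : phi i (sample n x) @[n --> \oo] --> phi i x.
    have [/(_ [::])[/= cphi _] _] := tphi i.
    exact: (continuous_cvg _ (cphi x) sample_cvg).
  rewrite -[phi i x]add0r.
  rewrite (_ : (fun n => step_field (k n) i x) =
    (fun n => (step_field (k n) i x - phi i (sample n x)) + phi i (sample n x))).
    apply: cvgD phi_cvg; apply/cvgrPdist_le => r r0.
    move/cvgrPdist_le : inv0 => /(_ r r0)[N _ Nr]; exists N => // n /= Nn.
    rewrite sub0r normrN (le_trans (kE _ _ _))//.
    by have := Nr n Nn; rewrite sub0r normrN ger0_norm// invr_ge0.
  by apply/funext => n; rewrite subrK.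
have int_cvg i : \int[dx]_x ((phi i x - step_field (k n) i x) *
    (phi i x - step_field (k n) i x)) @[n --> \oo] --> (0 : R).
  have [M phiM] := test_function_bounded (tphi i).
  have mphi : measurable_fun setT (phi i : R3m R -> measurableTypeR R).
    by apply: measurable_continuous3; have [/(_ [::])[]] := tphi i.
  apply: (fine_cvg (a := 0)).
  have [] := @dominated_convergence _ _ _ dx setT measurableT
    (fun n x => ((phi i x - step_field (k n) i x) * (phi i x - step_field (k n) i x))%:E)
    (cst 0%E) (cst ((M + M + 1) ^+ 2)%:E).
  - move=> n; apply/measurable_EFinP.
    by apply: measurable_funM; apply: measurable_funB => //; exact: measurable_step_field.
  - exact: measurable_cst.
  - apply: ae_domain => x Ox _; apply: cvg_EFin; first exact: nearW.
    have d0 : phi i x - step_field (k n) i x @[n --> \oo] --> 0.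
      by rewrite -(subrr (phi i x)); apply: cvgB; [exact: cvg_cst|exact: kcvg].
    by rewrite -(mulr0 0); exact: cvgM.
  - apply/integrableP; split => //; rewrite integral_cst// lte_mul_pinfty//.
    exact: dx_finite.
  - apply: aeW => x n _; rewrite lee_fin -expr2 normrX lerXn2r ?nnegrE//.
      by rewrite addr_ge0// addr_ge0// (le_trans _ (phiM x)).
    have n1 : n.+1%:R^-1 <= 1 :> R by rewrite invf_le1// ler1n.
    move: n.+1%:R^-1 n1 (kE n i x) => h n1.
    have := phiM (sample n x); have := phiM x.
    rewrite !ler_norml => /andP[? ?] /andP[? ?] /andP[? ?].
    by apply/andP; split; lra.
  by rewrite integral0 => _ _.
have norm_cvg :
    norm2 (fun i x => phi i x - step_field (k n) i x) @[n --> \oo] --> (0 : R).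
  rewrite (_ : 0 = \sum_(i < 3) (0 : R)); last by rewrite big1.
  by apply: cvg_big => //; exact: add_continuous.
move/cvgrPdist_lt : norm_cvg => /(_ e e0)[N _ /(_ N (leqnn N))].
by rewrite sub0r normrN ger0_norm ?norm2_ge0// => ?; exists (k N).
Qed.

End density.

(** * Half-spaces generate the Borel sets of H *)

Section borel_H_generation.
Context (R : realType) (Omega : smooth_domain R).
Local Notation dx := (dx Omega).
Local Notation inner := (inner Omega).
Local Notation norm2 := (norm2 Omega).
Local Notation H := (H Omega).
Implicit Types (k : grid_code) (u v : H).

Definition coord k v : R := inner (Hrep v) (step_field k).

Lemma sqint_Hrep v : sqint Omega (Hrep v).
Proof. exact: sqint_rep. Qed.
Hint Resolve sqint_Hrep sqint_step_field : core.

Lemma norm2_triangle (e : R) F G : sqint Omega F -> sqint Omega G -> 0 < e ->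
  norm2 (fun i x => F i x + G i x) <= (1 + e^-1) * norm2 F + (1 + e) * norm2 G.
Proof.
move=> sF sG e0; have := inner_young sF sG e0; have := ler_norm (inner F G).
rewrite (_ : (fun i x => F i x + G i x) = (fun i x => 1 * F i x + G i x)).
  by rewrite norm2_lin// expr1n !mul1r mulr1 !mulrDl !mul1r; lra.
by apply/funext => i; apply/funext => x; rewrite mul1r.
Qed.

Lemma norm2_triangle2 F G K : sqint Omega F -> sqint Omega G -> sqint Omega K ->
  norm2 (fun i x => F i x - K i x) <=
  2 * norm2 (fun i x => F i x - G i x) + 2 * norm2 (fun i x => G i x - K i x).
Proof.
move=> sF sG sK; have := norm2_triangle (sqintB sF sG) (sqintB sG sK) (@ltr01 R).
rewrite invr1 (_ : (fun i x => _ + _) = (fun i x => F i x - K i x))//.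
by apply/funext => i; apply/funext => x; rewrite addrA subrK.
Qed.

Lemma step_field_near v (e : R) : 0 < e ->
  exists k, norm2 (fun i x => Hrep v i x - step_field k i x) < e.
Proof.
move=> e0; have e40 : 0 < e / 4 by rewrite divr_gt0.
have [phi [tphi _] vphi] := set_mem (valP v) _ e40.
have [k phik] := step_field_dense tphi e40; exists k.
have := norm2_triangle2 (sqint_Hrep v) (sqint_test_field tphi) (sqint_step_field Omega k).
by rewrite /Hrep /Hfield in vphi *; lra.
Qed.

(** Since |v - d|^2 = |v|^2 - (2 (v, d) - |d|^2) can be made arbitrarily small,
    |v|^2 is the supremum of 2 (v, d) - |d|^2 over the step fields d. *)
Lemma norm2_leP v (c : R) : norm2 (Hrep v) <= c <->
  forall k, 2 * coord k v - norm2 (step_field k) <= c.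
Proof.
have nB k : norm2 (fun i x => Hrep v i x - step_field k i x) =
    norm2 (Hrep v) - 2 * coord k v + norm2 (step_field k) by rewrite norm2B.
split=> [vc k|vc].
  by have := norm2_ge0 Omega (fun i x => Hrep v i x - step_field k i x); rewrite nB; lra.
apply/ler_addgt0Pr => e e0; have [k] := step_field_near v e0.
by rewrite nB; have := vc k; lra.
Qed.

Definition halfspaces (s : seq (grid_code * rat)) : set H :=
  [set v | forall p, p \in s -> coord p.1 v < ratr p.2].

(** H with the sigma-algebra that the half-spaces generate, a priori smaller than
    the Borel one. *)
Definition borel_halfspaces := g_sigma_algebraType (range halfspaces).

Lemma measurable_coord_halfspaces k :
  measurable_fun setT (coord k : borel_halfspaces -> R).
Proof.
apply: measurable_fun_ltP => c.
have -> : [set v : borel_halfspaces | coord k v < c] =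
    \bigcup_(q in [set q : rat | ratr q < c]) halfspaces [:: (k, q)].
  apply/seteqP; split=> [v /= vc|v [q /= qc vq]].
    have [q] := rat_in_itvoo vc; rewrite in_itv/= => /andP[vq qc].
    by exists q => // p; rewrite inE => /eqP ->.
  exact: lt_trans (vq (k, q) (mem_head _ _)) qc.
rewrite bigcup_mkcond; apply: countable_bigcupT_measurable => [|q].
  exact: countableP.
by case: ifPn => // _; apply: sub_sigma_algebra; exists [:: (k, q)].
Qed.

Lemma measurable_norm2_halfspaces :
  measurable_fun setT (fun v : borel_halfspaces => norm2 (Hrep v)).
Proof.
apply: measurable_fun_leP => c.
have -> : [set v : borel_halfspaces | norm2 (Hrep v) <= c] =
    \bigcap_k [set v | 2 * coord k v - norm2 (step_field k) <= c].
  apply/seteqP; split=> [v /norm2_leP vc k _|v vc]; first exact: vc.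
  by apply/norm2_leP => k; exact: vc.
rewrite -[X in measurable X]setCK setC_bigcap; apply: measurableC.
apply: countable_bigcupT_measurable => [|k]; first exact: countableP.
apply: measurableC; rewrite -[X in measurable X]setTI.
apply: measurable_fun_ler => //; apply: measurable_funB => //.
by apply: measurable_funM => //; exact: measurable_coord_halfspaces.
Qed.

(** By separability an open set is the union of the countably many balls with a
    step field as centre and a rational squared radius that it contains, and
    such balls are measurable because |v - d|^2 is a combination of |v|^2 and of
    the coordinate (v, d). *)
Lemma open_H_halfspaces (A : set H) : open_H A -> <<s range halfspaces >> A.
Proof.
move=> oA; pose B (p : grid_code * rat) : set H :=
  [set v | norm2 (fun i x => Hrep v i x - step_field p.1 i x) < ratr p.2].
have -> : A = \bigcup_(p in [set p | B p `<=` A]) B p.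
  apply/seteqP; split=> [u Au|u [p]]; last exact.
  have [e e0 ueA] := oA _ Au.
  (* The quasi-triangle inequality costs a factor 2 on each squared distance:
     for q <= e^2 / 8 the ball of squared radius q around a step field at squared
     distance less than q from u stays within squared distance e^2 of u. *)
  have e80 : 0 < e ^+ 2 / 8 by rewrite divr_gt0// exprn_gt0.
  have [k uk] := step_field_near u e80.
  have [q] := rat_in_itvoo uk; rewrite in_itv/= => /andP[uq qe].
  exists (k, q) => //= v vq; apply: ueA.
  have := norm2_triangle2 (sqint_Hrep u) (sqint_step_field Omega k) (sqint_Hrep v).
  have -> : norm2 (fun i x => step_field k i x - Hrep v i x) =
      norm2 (fun i x => Hrep v i x - step_field k i x).
    by rewrite !norm2B// [inner (step_field _) _]innerC; ring.
  by rewrite /B/= in vq; lra.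
suff mB p : <<s range halfspaces >> (B p).
  rewrite bigcup_mkcond.
  apply: (@countable_bigcupT_measurable _ borel_halfspaces) => [|p].
    exact: countableP.
  by case: ifPn => _; [exact: mB|exact: (@measurable0 _ borel_halfspaces)].
have mn : measurable_fun setT
    (fun v : borel_halfspaces => norm2 (Hrep v) - 2 * coord p.1 v + norm2 (step_field p.1)).
  apply: measurable_funD => //; apply: measurable_funB.
    exact: measurable_norm2_halfspaces.
  by apply: measurable_funM => //; exact: measurable_coord_halfspaces.
have mlt : measurable_fun setT (fun v : borel_halfspaces =>
    norm2 (Hrep v) - 2 * coord p.1 v + norm2 (step_field p.1) < ratr p.2).
  exact: measurable_fun_ltr.
have := mlt measurableT [set true] I; rewrite setTI; congr (<<s range halfspaces >>).
by apply/seteqP; split => v /=; rewrite /B/= norm2B//.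
Qed.

(** Young's inequality bounds the variation of the coordinate on a ball of
    radius r by r (1 + |d|^2) / 2, where d is the step field. *)
Lemma open_H_coord_lt k (c : R) : open_H [set v | coord k v < c].
Proof.
move=> u /= uc; set b := norm2 (step_field k).
have b0 : 0 <= b by exact: norm2_ge0.
pose r := (c - coord k u) / (1 + b).
have r0 : 0 < r by rewrite divr_gt0 ?subr_gt0// ltr_pwDl.
exists r => // v vr; pose D : field R := fun i x => Hrep u i x - Hrep v i x.
have sD : sqint Omega D by exact: sqintB.
have Dk : inner D (step_field k) = coord k u - coord k v.
  rewrite /D (_ : (fun i x => _) = (fun i x => -1 * Hrep v i x + Hrep u i x)).
    by rewrite inner_linl// /coord; ring.
  by apply/funext => i; apply/funext => x; rewrite mulN1r addrC.
have := inner_young sD (sqint_step_field Omega k) r0; rewrite Dk => /le_lt_trans h.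
have {h} : 2 * `|coord k u - coord k v| < r * (1 + b).
  by apply: h; rewrite mulrDr mulr1 ltrD2r mulrC ltr_pdivrMr// -expr2.
have b1 : 1 + b != 0 by rewrite gt_eqF// ltr_pwDl.
rewrite /r divfK// => h.
have := ler_norm (coord k v - coord k u); rewrite distrC /=; lra.
Qed.

Lemma measurable_coord k : measurable_fun setT (coord k : borel_H Omega -> R).
Proof.
apply: measurable_fun_ltP => c; apply: sub_sigma_algebra; exact: open_H_coord_lt.
Qed.

Lemma measurable_halfspaces s : measurable (halfspaces s : set (borel_H Omega)).
Proof.
have -> : halfspaces s = \bigcap_(p in [set p | p \in s]) [set v | coord p.1 v < ratr p.2].
  by apply/seteqP; split.
rewrite bigcap_seq; elim/big_rec : _ => // p A _ mA; apply: measurableI => //.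
rewrite -[X in measurable X]setTI.
by apply: measurable_fun_ltr => //; exact: measurable_coord.
Qed.

(** Half-space intersections are stable under intersection, so Dynkin's theorem
    applies. *)
Lemma borel_H_measure_unique (mu mu' : probability (borel_H Omega) R) :
  (forall s, mu (halfspaces s) = mu' (halfspaces s)) ->
  forall A : set (borel_H Omega), measurable A -> mu A = mu' A.
Proof.
move=> mumu' A mA.
have nilT : halfspaces [::] = setT by apply/seteqP; split.
have mG : range halfspaces `<=` @measurable _ (borel_H Omega).
  by move=> _ [s _ <-]; exact: measurable_halfspaces.
have GT (n : nat) : range halfspaces (setT : set (borel_H Omega)) by exists [::].
have GI : setI_closed (range halfspaces).
  move=> _ _ [s _ <-] [t _ <-]; exists (s ++ t) => //.
  apply/seteqP; split=> [v vst|v [vs vt] p].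
    by split=> p ps; apply: vst; rewrite mem_cat ps ?orbT.
  by rewrite mem_cat => /orP[/vs|/vt].
have GU : \bigcup_(n : nat) (setT : set (borel_H Omega)) = setT.
  by rewrite bigcup_const.
apply: (@g_sigma_algebra_measure_unique _ R (borel_H Omega) (range halfspaces)
  mG (fun=> setT) GT GU mu mu' GI).
- by move=> _ [s _ <-]; exact: mumu'.
- by move=> _; rewrite /= probability_setT ltry.
- apply: smallest_sub mA; first exact: smallest_sigma_algebra.
  by move=> B; exact: open_H_halfspaces.
Qed.

End borel_H_generation.

(** * Measurability of the shift and of the trajectories *)

Section trajectories.
Context (R : realType) (Omega : smooth_domain R).
Local Notation inner := (inner Omega).
Local Notation norm2 := (norm2 Omega).
Local Notation H := (H Omega).
Local Notation Hw := (Hw Omega).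
Local Notation Cw := (Cw Omega).
Local Notation Cw_top := (Cw_top Omega).
Implicit Types (k : grid_code) (v : H) (u : Cw).

Lemma coord_linear k : linear_H (coord k : H -> R).
Proof.
move=> a u v w wE.
rewrite /coord -inner_linl//;
  [|exact: sqint_Hrep|exact: sqint_Hrep|exact: sqint_step_field].
apply: inner_ae => //; [exact: sqint_Hrep| |exact: sqint_step_field].
by apply: sqint_lin; exact: sqint_Hrep.
Qed.

Lemma coord_bounded k : bounded_H (coord k : H -> R).
Proof.
exists ((1 + norm2 (step_field k)) / 2) => v.
by apply: inner_bounded; [exact: sqint_Hrep|exact: sqint_step_field].
Qed.

Definition coord_dual k : dual_H Omega :=
  SigSub (mem_set (conj (coord_linear k) (coord_bounded k))).

Lemma coord_weak_continuous k : continuous (coord k : Hw -> R).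
Proof.
have cp : continuous (@pairing R Omega : Hw -> {ptws dual_H Omega -> R}).
  exact: initial_continuous.
move=> v; exact: (cvg_comp _ _ (cp v) (@proj_continuous _ (fun=> R) (coord_dual k) _)).
Qed.

Lemma Cw_to_family_continuous : continuous (@Cw_to_family R Omega : Cw_top -> _).
Proof. exact: initial_continuous. Qed.

Lemma eval_continuous (t : nneg R) :
  continuous (fun u : Cw_top => (u : continuousType (nneg R) Hw) t : Hw).
Proof.
move=> u A; rewrite -nbhs_entourageE => -[E entE EA].
have tK : @compact_subinterval R [set t].
  exists (set_val t), (set_val t); apply/seteqP; split=> s /=.
    by move=> ->; rewrite lexx.
  by rewrite -eq_le => /eqP/val_inj.
have := @Cw_to_family_continuous u _ (fam_nbhs (Cw_to_family u) entE tK).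
move=> uE; apply: (filterS (F := nbhs (u : Cw_top)) _ uE) => v /= /(_ t erefl) uv.
by apply: EA; exact/xsectionP.
Qed.

Lemma set_val_to_nneg (t : R) : 0 <= t -> (set_val (to_nneg t) : R) = t.
Proof. by move=> t0; transitivity (Num.max 0 t) => //; exact/max_idPr. Qed.

Lemma nneg_ge0 (t : nneg R) : 0 <= (set_val t : R).
Proof. by have := set_mem (valP t); rewrite /= in_itv/= andbT. Qed.

(** Uniform convergence of the translates on [a, b] is uniform convergence on
    [a + tau, b + tau]. *)
Lemma sigma_continuous (tau : nneg R) :
  continuous (@sigma R Omega tau : Cw_top -> Cw_top).
Proof.
apply: continuous_comp_initial => u.
have FF : Filter ((@Cw_to_family R Omega \o sigma tau) @ nbhs (u : Cw_top)).
  exact: fmap_filter.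
apply/(@fam_cvgP _ _ _ _ _ FF) => K [a [b ->]].
move=> P /uniform_nbhs[E [entE EP]].
have shiftE (s : nneg R) :
    (set_val (Defs.shift tau s) : R) = (set_val s : R) + (set_val tau : R).
  by rewrite set_val_to_nneg// addr_ge0// nneg_ge0.
pose c : R := set_val tau.
have tK : @compact_subinterval R [set t | a + c <= set_val t <= b + c].
  by exists (a + c), (b + c).
have := @Cw_to_family_continuous u _ (fam_nbhs (Cw_to_family u) entE tK).
move=> uE; apply: (filterS (F := nbhs (u : Cw_top)) _ uE) => v /= uv.
apply: EP => s /= sab.
by apply: (uv (Defs.shift tau s)); rewrite shiftE !lerD2r.
Qed.

Lemma measurable_sigma (tau : nneg R) :
  measurable_fun setT (@sigma R Omega tau : borel_Cw Omega -> borel_Cw Omega).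
Proof.
apply: (@measurability _ _ (borel_Cw Omega) (borel_Cw Omega) setT _
  (@open Cw_top) erefl).
move=> _ [A oA <-]; rewrite setTI; apply: sub_sigma_algebra.
by move/continuousP : (@sigma_continuous tau); exact.
Qed.

Lemma measurable_coord_at_time k (t : R) :
  measurable_fun setT (fun u : borel_Cw Omega => coord k (at_time u t)).
Proof.
apply: measurable_fun_ltP => c; apply: sub_sigma_algebra.
have cE : continuous (fun u : Cw_top => coord k (at_time u t)).
  move=> u.
  exact: (cvg_comp _ _ (@eval_continuous (to_nneg t) u) (@coord_weak_continuous k _)).
move/continuousP : cE => /(_ [set y | y < c]); apply; exact: open_lt.
Qed.

Lemma to_nneg_continuous : continuous (@to_nneg R).
Proof.
apply: continuous_comp_initial => t.
by apply: (@continuous_max _ R (cst 0) id); [exact: cst_continuous|exact: cvg_id].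
Qed.

Lemma coord_at_time_continuous k u : continuous (fun t : R => coord k (at_time u t)).
Proof.
have cu : continuous (fun t : R => (u : continuousType (nneg R) Hw) (to_nneg t)).
  move=> t; apply: (@continuous_comp R (nneg R) Hw (@to_nneg R)).
    exact: to_nneg_continuous.
  exact: cts_fun.
move=> t; exact: (cvg_comp _ _ (cu t) (@coord_weak_continuous k _)).
Qed.

End trajectories.

(** * Time averages along almost every trajectory *)

(** The function is the pointwise limit of its versions frozen at the grid point
    of t, which only involve finitely many measurable functions of x as t varies. *)
Lemma measurable_fun_caratheodory d (X : measurableType d) (R : realType)
    (f : R -> X -> R) :
  (forall t, measurable_fun setT (f t)) -> (forall x, continuous (f^~ x)) ->
  measurable_fun setT (fun p : measurableTypeR R * X => f p.1 p.2).
Proof.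
move=> mf cf.
pose h n (p : measurableTypeR R * X) := f (grid_point R (grid_index n p.1)) p.2.
apply: (@measurable_fun_cvg _ _ _ setT h).
  move=> n _ Y mY; rewrite setTI.
  have -> : h n @^-1` Y = \bigcup_c
      ((grid_index n @^-1` [set c]) `*` (f (grid_point R c) @^-1` Y)).
    apply/seteqP; split=> [[t x] tx|[t x] [c _ [/= tc cY]]].
      by exists (grid_index n t).
    by rewrite /h/= tc.
  apply: countable_bigcupT_measurable => [|c]; first exact: countableP.
  apply: measurableX; first exact: measurable_grid_index.
  by rewrite -[X in measurable X]setTI; exact: mf.
move=> [t x] _; apply: (continuous_cvg _ (cf x t)).
apply/cvgrPdist_le => e e0.
have [N _ Ne] := near_infty_natSinv_lt (PosNum e0).
exists (maxn N (Num.bound `|t|)) => // n /=; rewrite geq_max => /andP[Nn tn].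
rewrite distrC (le_trans (grid_point_dist _))//.
  by rewrite (le_trans (ltW (archi_boundP _)))// ler_nat.
exact: ltW (Ne n Nn).
Qed.

Section ergodic_averages.
Context (R : realType) (Omega : smooth_domain R).
Local Notation Cw := (Cw Omega).
Local Notation leb := (@lebesgue_measure R).
Implicit Types (u : Cw) (s : seq (grid_code * rat)).

Lemma measurable_halfspaces_at_time s :
  measurable [set p : measurableTypeR R * borel_Cw Omega |
    halfspaces s (at_time p.2 p.1)].
Proof.
have -> : [set p : measurableTypeR R * borel_Cw Omega | halfspaces s (at_time p.2 p.1)] =
  \bigcap_(q in [set q | q \in s])
    [set p | coord q.1 (at_time p.2 p.1) < ratr q.2].
  by apply/seteqP; split.
rewrite bigcap_seq; elim/big_rec : _ => // q A _ mA; apply: measurableI => //.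
rewrite -[X in measurable X]setTI; apply: measurable_fun_ltr => //.
apply: (@measurable_fun_caratheodory _ (borel_Cw Omega) R
  (fun t u => coord q.1 (at_time u t))).
- by move=> t; exact: measurable_coord_at_time.
- by move=> u; exact: coord_at_time_continuous.
Qed.

(** Its average over [0, T] is the fraction of time that u spends in the
    intersection of half-spaces. *)
Definition occupation s (t : R) (u : Cw) : R :=
  \1_(halfspaces s : set (borel_H Omega)) (at_time u t).

Lemma occupation01 s t u : 0 <= occupation s t u <= 1.
Proof. by rewrite /occupation indicE; case: (_ \in _); rewrite lexx ler01. Qed.

Lemma measurable_occupation s : measurable_fun setT
  (fun p : measurableTypeR R * borel_Cw Omega => occupation s p.1 p.2).
Proof.
have : measurable_fun setT (\1_[set p : measurableTypeR R * borel_Cw Omega |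
    halfspaces s (at_time p.2 p.1)] : _ -> R).
  by apply: measurable_indic; exact: measurable_halfspaces_at_time.
congr measurable_fun; apply/funext => p; rewrite /occupation !indicE.
Qed.

Lemma at_time_sigma1 (t : R) u : 0 <= t ->
  at_time u (t + 1) = at_time (sigma (to_nneg 1) u) t.
Proof.
move=> t0; rewrite /at_time /=; congr ((u : continuousType (nneg R) (Hw Omega)) _).
by apply: val_inj; rewrite /= !set_val_to_nneg.
Qed.

(** The countability of the codes s allows a single exceptional null set. *)
Lemma occupation_average_cvg nu f (rho : probability (borel_Cw Omega) R) :
  invariant_VF nu f rho ->
  {ae rho, forall u, forall s,
    cvg (time_average u (\1_(halfspaces s : set (borel_H Omega))) @ +oo)}.
Proof.
move=> [_ inv].
have avg s : {ae rho, forall u : borel_Cw Omega,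
    cvg (time_average u (\1_(halfspaces s : set (borel_H Omega))) @ +oo)}.
  apply: (@birkhoff_ergodic_continuous _ _ R rho (sigma (to_nneg 1)) (occupation s)).
  - exact: measurable_sigma.
  - by move=> E mE; exact: inv.
  - exact: measurable_occupation.
  - exact: occupation01.
  - by move=> t u t0; rewrite /occupation at_time_sigma1.
pose avg_option (o : option (seq (grid_code * rat))) (u : borel_Cw Omega) :=
  if o is Some s then
    cvg (time_average u (\1_(halfspaces s : set (borel_H Omega))) @ +oo) else True.
have : {ae rho, forall u : borel_Cw Omega, forall n : nat, avg_option (unpickle n) u}.
  apply: (ae_foralln (P := fun n => avg_option (unpickle n))) => n.
  move: (unpickle n) => -[s|]; first exact: avg.
  exact: aeW.
by apply: filterS => u uavg s; have := uavg (pickle s); rewrite pickleK.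
Qed.

(** A generalized limit is known to extend the limit only on L^oo, which the
    averages have to be shown to belong to. *)
Lemma time_average_Linfty u s :
  time_average u (\1_(halfspaces s : set (borel_H Omega))) \in @Linfty R.
Proof.
have mo : measurable_fun setT (fun t : measurableTypeR R => occupation s t u).
  exact: (measurableT_comp (measurable_occupation s) (@measurable_pair2 _ _ _ _ _)).
have o01 t := occupation01 s t u.
pose I T := \int[leb]_(t in `[0, T]) occupation s t u.
have I0 T : T < 0 -> I T = 0.
  by move=> T0; rewrite /I set_itv_ge ?Rintegral_set0// bnd_simp -ltNge.
have IT T : 0 <= T -> 0 <= I T <= T.
  by move=> T0; have := Rintegral_itvcc_bounds mo o01 T0; rewrite subr0.
have Iincr : nondecreasing_fun I.
  move=> S T ST; have [S0|S0] := ltP S 0.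
    rewrite (I0 S)//; have [T0|T0] := ltP T 0; first by rewrite I0.
    by case/andP: (IT T T0).
  rewrite /I (@Rintegral_incr _ _ mo o01 S T) ?S0// lerDl.
  by case/andP: (Rintegral_itvcc_bounds mo o01 ST).
rewrite inE; apply/andP; split; rewrite inE/=.
  (* Away from ]0, +oo[ the integral vanishes, so that the inverse may be
     replaced by the measurable function exp (- ln T). *)
  rewrite (_ : time_average u _ = (fun T => expR (- ln T) * I T)).
    apply: measurable_funM; last exact: nondecreasing_measurable.
    by apply: measurableT_comp => //; apply: measurableT_comp => //; exact: measurable_ln.
  apply/funext => T; rewrite /time_average -/(I T).
  have [T0|] := ltP 0 T; first by rewrite expRN lnK.
  rewrite le_eqVlt => /predU1P[->|T0]; last by rewrite I0// !mulr0.
  by rewrite /I set_itv1 Rintegral_set1 !mulr0.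
rewrite /finite_norm unlock /Lnorm; case: ifPn => // _.
apply: (@le_lt_trans _ _ 1%E); last exact: ltry.
apply/ess_supP; apply: aeW => T /=; rewrite lee_fin /time_average -/(I T).
have [T0|T0] := ltP T 0; first by rewrite I0// mulr0 normr0.
have [->|Tn0] := eqVneq T 0; first by rewrite invr0 mul0r normr0.
have T1 : 0 < T by rewrite lt_neqAle eq_sym Tn0.
have /andP[? ?] := IT T T0.
by rewrite ger0_norm ?mulr_ge0 ?invr_ge0// ler_pdivrMl// mulr1.
Qed.

End ergodic_averages.

Theorem theorem1p2 (R : realType) (Omega : smooth_domain R) (nu : R)
    (f : H Omega) (rho : probability (borel_Cw Omega) R)
    (Lim Lim' : (R -> R) -> R) :
  0 < nu ->
  invariant_VF nu f rho ->
  generalized_limit Lim ->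
  generalized_limit Lim' ->
  {ae rho, forall u, leray_hopf nu f u ->
    forall mu mu' : probability (borel_H Omega) R,
      time_average_stationary nu f Lim u mu ->
      time_average_stationary nu f Lim' u mu' ->
      forall A : set (borel_H Omega), measurable A -> mu A = mu' A}.
Proof.
move=> _ inv gL gL'; have := occupation_average_cvg inv.
apply: filterS; first exact: (ae_filter_ringOfSetsType rho).
move=> u uavg _ mu mu' [_ muE] [_ muE']; apply: borel_H_measure_unique => s.
have /cvg_ex[l ul] := uavg s.
have hL := time_average_Linfty u s.
have mPhi : measurable_fun setT
    (\1_(halfspaces s : set (borel_H Omega)) : borel_H Omega -> R).
  by apply: measurable_indic; exact: measurable_halfspaces.
have bPhi : exists M : R, forall v, `|\1_(halfspaces s : set (borel_H Omega)) v| <= M.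
  by exists 1 => v; rewrite indicE; case: (_ \in _); rewrite ?normr0 ?normr1.
have E (m : probability (borel_H Omega) R) :
    \int[m]_v \1_(halfspaces s : set (borel_H Omega)) v = fine (m (halfspaces s)).
  by rewrite /Rintegral integral_indic ?setIT//; exact: measurable_halfspaces.
have := muE _ mPhi bPhi; have := muE' _ mPhi bPhi.
rewrite (gl_extends gL hL ul) (gl_extends gL' hL ul) !E => -> mm'.
by rewrite -[LHS]fineK ?fin_num_measure//; [rewrite -mm' fineK// fin_num_measure//|];
  exact: measurable_halfspaces.
Qed.
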